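(* Let $p\in(0,1]$. For every $p$-natural quasi-Banach space $E$, the free $p$-convex $p$-Banach lattice generated by $E$ exists. That is, there exist a $p$-convex $p$-Banach lattice $\mathrm{FpBL}^{(p)}[E]$ with $M^{(p)}(\mathrm{FpBL}^{(p)}[E])=1$ and a linear isometric embedding $\delta:E\to\mathrm{FpBL}^{(p)}[E]$ such that for every $p$-convex $p$-Banach lattice $X$ and every operator $T:E\to X$ there is a unique lattice homomorphism $\widehat T:\mathrm{FpBL}^{(p)}[E]\to X$ with $\widehat T\delta=T$, and moreover $\|\widehat T\|\le M^{(p)}(X)\,\|T\|$.
   Context: All spaces are real. A $p$-norm ($0<p\le1$) is a map $\|\cdot\|:E\to[0,\infty)$ with $\|e\|=0\Rightarrow e=0$, $\|\lambda e\|=|\lambda|\|e\|$, $\|e+e'\|^p\le\|e\|^p+\|e'\|^p$; a quasi-norm satisfies instead of the last condition $\|e+e'\|\le\Delta(\|e\|+\|e'\|)$ for some $\Delta\ge 1$. Complete $p$-normed (quasi-normed) spaces are $p$-Banach (quasi-Banach) spaces; those which are also vector lattices with $|x|\le|y|\Rightarrow\|x\|\le\|y\|$ are $p$-Banach (quasi-Banach) lattices. ''Operator'' means continuous linear map; lattice homomorphisms are linear, continuous and preserve finite suprema and infima. A quasi-Banach lattice $X$ is $p$-convex if there is $C>0$ with $\|(\sum_{k=1}^n|x_k|^p)^{1/p}\|\le C(\sum_{k=1}^n\|x_k\|^p)^{1/p}$ for all finite families in $X$ (Krivine functional calculus); the infimum of such $C$ is $M^{(p)}(X)$. A quasi-Banach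 space $E$ is $p$-natural if it embeds linearly and isometrically into a $p$-convex $p$-Banach lattice $X$ with $M^{(p)}(X)=1$.
   Formalization: The infimum defining M^(p)(X) is taken over constants C ≥ 1, so the zero lattice has M^(p) = 1; read literally it would have M^(p) = 0 and the claim would fail for E = {0}. For nonzero lattices nothing changes. *)

(* Defs.v *)
From HB Require Import structures.
From mathcomp Require Export all_boot all_order all_algebra.
From mathcomp Require Export all_classical all_reals all_analysis.

Set Implicit Arguments.
Unset Strict Implicit.
Unset Printing Implicit Defensive.

Import Order.TTheory GRing.Theory Num.Theory.
Import numFieldNormedType.Exports.

Local Open Scope classical_set_scope.
Local Open Scope ring_scope.

(** ** Quasi-normed and quasi-Banach spaces *)

HB.mixin Record Lmodule_isQuasiNormed (R : realType) E of GRing.Lmodule R E := {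
  qnorm : E -> R ;
  qnorm_ge0 : forall e, 0 <= qnorm e ;
  qnorm_eq0 : forall e, qnorm e = 0 -> e = 0 ;
  qnormZ : forall (a : R) e, qnorm (a *: e) = `|a| * qnorm e ;
  qnormD : exists2 D : R, 1 <= D &
    forall e e', qnorm (e + e') <= D * (qnorm e + qnorm e')
}.

#[short(type="quasiNormedType")]
HB.structure Definition QuasiNormed (R : realType) :=
  { E of GRing.Lmodule R E & Lmodule_isQuasiNormed R E }.

(* The vector topology of a quasi-norm has the sets
   [{y | qnorm (y - x) < eps}] as a basis of neighbourhoods of [x]; it is
   metrizable, so completeness is completeness for sequences. *)
HB.mixin Record QuasiNormed_isComplete (R : realType) E of QuasiNormed R E := {
  qcomplete : forall u : nat -> E,
    (forall eps : R, 0 < eps ->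
       exists N, forall m n, (N <= m)%N -> (N <= n)%N ->
         qnorm (u m - u n) < eps) ->
    exists l : E, qnorm (u n - l) @[n --> \oo] --> (0 : R)
}.

#[short(type="quasiBanachType")]
HB.structure Definition QuasiBanach (R : realType) :=
  { E of QuasiNormed R E & QuasiNormed_isComplete R E }.

(* [p]-normed spaces are quasi-normed with [D = 2 `^ (p^-1 - 1)], so
   "[p]-Banach" is "quasi-Banach" together with this property. *)
Definition pnormed (R : realType) (p : R) (E : quasiNormedType R) : Prop :=
  forall e e' : E, qnorm (e + e') `^ p <= qnorm e `^ p + qnorm e' `^ p.

Definition qcontinuous (R : realType) (E F : quasiNormedType R)
    (f : E -> F) : Prop :=
  forall x (eps : R), 0 < eps -> exists2 d : R, 0 < d &
    forall y, qnorm (y - x) < d -> qnorm (f y - f x) < eps.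

Definition operator (R : realType) (E F : quasiNormedType R)
    (f : E -> F) : Prop :=
  linear f /\ qcontinuous f.

Definition opnorm (R : realType) (E F : quasiNormedType R) (f : E -> F) : R :=
  sup [set qnorm (f x) | x in [set x : E | qnorm x <= 1]].

(** ** Vector lattices and quasi-Banach lattices *)

(* The order and lattice operations are fields of the mixin: joining MathComp's
   [Order.Lattice] with [GRing.Lmodule] is not possible downstream of
   [Num.RealDomain]. *)
HB.mixin Record Lmodule_isVectorLattice (R : realType) X of GRing.Lmodule R X := {
  vle : X -> X -> Prop ;
  vjoin : X -> X -> X ;
  vmeet : X -> X -> X ;
  vle_refl : forall x, vle x x ;
  vle_anti : forall x y, vle x y -> vle y x -> x = y ;
  vle_trans : forall y x z, vle x y -> vle y z -> vle x z ;
  vjoin_lub : forall x y z, vle (vjoin x y) z <-> vle x z /\ vle y z ;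
  vmeet_glb : forall x y z, vle z (vmeet x y) <-> vle z x /\ vle z y ;
  vleD : forall z x y, vle x y -> vle (x + z) (y + z) ;
  vleZ : forall (a : R) x, 0 <= a -> vle 0 x -> vle 0 (a *: x)
}.

#[short(type="vectorLatticeType")]
HB.structure Definition VectorLattice (R : realType) :=
  { X of GRing.Lmodule R X & Lmodule_isVectorLattice R X }.

Definition vabs (R : realType) (X : vectorLatticeType R) (x : X) : X :=
  vjoin x (- x).

HB.mixin Record isQuasiBanachLattice (R : realType) X
    of QuasiBanach R X & VectorLattice R X := {
  qnorm_vabs : forall x y : X, vle (vabs x) (vabs y) -> qnorm x <= qnorm y
}.

#[short(type="quasiBanachLatticeType")]
HB.structure Definition QuasiBanachLattice (R : realType) :=
  { X of QuasiBanach R X & VectorLattice R X & isQuasiBanachLattice R X }.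

Definition lattice_hom (R : realType) (X Y : quasiBanachLatticeType R)
    (f : X -> Y) : Prop :=
  [/\ operator f,
      forall x y, f (vjoin x y) = vjoin (f x) (f y) &
      forall x y, f (vmeet x y) = vmeet (f x) (f y)].

(** ** Krivine functional calculus *)

Definition pos_homogeneous (R : realType) (n : nat) (h : 'rV[R]_n -> R) : Prop :=
  forall (a : R) (t : 'rV[R]_n), 0 <= a -> h (a *: t) = a * h t.

(* The lattice H_n of continuous positively homogeneous functions on R^n. *)
Definition Hcone (R : realType) (n : nat) : set ('rV[R]_n -> R) :=
  [set h | continuous h /\ pos_homogeneous h].

(* [tau], restricted to H_n, is a linear lattice homomorphism sending the
   [k]-th coordinate function to [x k]. *)
Definition functional_calculus (R : realType) (X : vectorLatticeType R)
    (n : nat) (x : 'I_n -> X) (tau : ('rV[R]_n -> R) -> X) : Prop :=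
  [/\ forall k, tau (fun t => t ord0 k) = x k,
      forall (a : R) g h, Hcone g -> Hcone h ->
        tau (fun t => a * g t + h t) = a *: tau g + tau h,
      forall g h, Hcone g -> Hcone h ->
        tau (fun t => Num.max (g t) (h t)) = vjoin (tau g) (tau h) &
      forall g h, Hcone g -> Hcone h ->
        tau (fun t => Num.min (g t) (h t)) = vmeet (tau g) (tau h)].

(* The element h(x_1, ..., x_n) of [X], for [h] in H_n. By Krivine's theorem
   a quasi-Banach lattice has a functional calculus at every finite family,
   unique on H_n, so the default value [0] is never used there. *)
Definition krivine (R : realType) (X : vectorLatticeType R)
    (n : nat) (x : 'I_n -> X) (h : 'rV[R]_n -> R) : X :=
  xget 0 [set y | exists2 tau, functional_calculus x tau & tau h = y].

Definition lp_fun (R : realType) (p : R) (n : nat) (t : 'rV[R]_n) : R :=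
  (\sum_(k < n) `|t ord0 k| `^ p) `^ p^-1.

(** ** p-convexity *)

Definition pconvex_with (R : realType) (p : R) (X : quasiBanachLatticeType R)
    (C : R) : Prop :=
  forall (n : nat) (x : 'I_n -> X),
    qnorm (krivine x (@lp_fun R p n)) <=
      C * (\sum_(k < n) qnorm (x k) `^ p) `^ p^-1.

Definition pconvex (R : realType) (p : R) (X : quasiBanachLatticeType R) : Prop :=
  exists2 C : R, 0 < C & pconvex_with p X C.

(* M^(p)(X). If [X] is not the zero lattice, one-element families force
   [1 <= C], so the infimum is the one over all constants [0 < C]. On the zero
   lattice every [0 < C] is admissible; restricting to [1 <= C] gives it the
   constant 1, so that it is the free lattice generated by the zero space. *)
Definition pconvexity_constant (R : realType) (p : R)
    (X : quasiBanachLatticeType R) : R :=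
  inf [set C : R | 1 <= C /\ pconvex_with p X C].

Definition isometric_embedding (R : realType) (E F : quasiNormedType R)
    (j : E -> F) : Prop :=
  linear j /\ forall e, qnorm (j e) = qnorm e.

Definition pnatural (R : realType) (p : R) (E : quasiBanachType R) : Prop :=
  exists (X : quasiBanachLatticeType R) (j : E -> X),
    [/\ pnormed p X, pconvex p X, pconvexity_constant p X = 1 &
        isometric_embedding j].

(* Main.v *)
From HB Require Import structures.
Require Import Defs.
From mathcomp Require Import ring lra generic_quotient ring_quotient.
From mathcomp Require finmap.

Import Order.TTheory GRing.Theory Num.Theory.
Import numFieldNormedType.Exports.

Set Implicit Arguments.
Unset Strict Implicit.
Unset Printing Implicit Defensive.

Local Open Scope classical_set_scope.
Local Open Scope ring_scope.

(** The free lattice is obtained from the free vector lattice over [E] by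
    writing down the largest admissible norm and completing.

    The free vector lattice [free_lattice E] consists of the functions on the
    algebraic dual of [E] generated by the evaluations [generator e] under
    linear operations and maxima. Each of them is a difference of two finite
    maxima, so positivity reduces to statements of the form: the maximum of
    finitely many vectors is nonnegative at every functional. By Gordan's
    alternative ([gordan]) this means that [0] is a convex combination of these
    vectors, an identity that every linear map preserves. Hence an inequality
    between lattice-linear expressions that holds for real functionals holds in
    every vector lattice ([word_transfer]), and a linear map from [E] into a
    vector lattice extends to a lattice homomorphism on [free_lattice E].

    The [p]-th power of the norm of [f] is taken to be the infimum of
    [\sum_e qnorm e `^ p] over the finite families of vectors [e] such that
    [`|f|] is at most [(\sum_e `|generator e| `^ p) `^ p^-1] pointwise. Two
    opposite estimates make this the right norm.
    - Concatenation of families shows that it is [p]-convex with constant [1],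
      and in particular a [p]-norm since [p <= 1] ([free_seminorm_pconvex]).
    - If [X] is [p]-convex with constant [C] and [T : E -> X] is an operator,
      the pointwise domination of [f] transfers to [X] by the functional
      calculus, and [p]-convexity bounds the image of [f] by [C] times the norm
      of [T] times the norm of [f] ([pconvex_word_bound], [free_ext_bounded]).
    The second estimate gives the universal property, with the constant
    [C = M^(p)(X)]. Applied to the embedding of [E] into a [p]-convex lattice of
    constant [1] given by naturality, it also shows that [generator] is
    isometric.

    The function [lp_fun p] behind [p]-convexity is not lattice-linear. It is
    approximated by lattice-linear expressions, uniformly with respect to the
    l1-norm ([word_approx]). Completeness of [X] then
    provides the functional calculus, whose values are characterized by such
    approximations ([krivine_value]). The same characterization carries
    [p]-convexity from the free vector lattice to its completion
    ([free_pconvex]). *)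

(** * Vector lattices *)

Section VectorLatticeTheory.
Context {R : realType} {X : vectorLatticeType R}.
Implicit Types (x y z : X) (a b : R).

Lemma vle_joinl x y : vle x (vjoin x y).
Proof. by have [] := (vjoin_lub x y (vjoin x y)).1 (vle_refl _). Qed.

Lemma vle_joinr x y : vle y (vjoin x y).
Proof. by have [] := (vjoin_lub x y (vjoin x y)).1 (vle_refl _). Qed.

Lemma vjoin_idPl x y : vle x y <-> vjoin x y = y.
Proof.
split=> [xy|<-]; last exact: vle_joinl.
apply: vle_anti; last exact: vle_joinr.
by apply/vjoin_lub; split=> //; exact: vle_refl.
Qed.

Lemma vle_anti_iff x y : (forall z, vle x z <-> vle y z) -> x = y.
Proof.
by move=> xy; apply: vle_anti; [apply/xy|apply/xy]; exact: vle_refl.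
Qed.

Lemma vjoinC x y : vjoin x y = vjoin y x.
Proof. by apply: vle_anti_iff => z; rewrite !vjoin_lub and_comm. Qed.

Lemma vjoinA x y z : vjoin x (vjoin y z) = vjoin (vjoin x y) z.
Proof. by apply: vle_anti_iff => t; rewrite !vjoin_lub and_assoc. Qed.

Lemma vjoinxx x : vjoin x x = x.
Proof. exact/vjoin_idPl/vle_refl. Qed.

Lemma vle_add2r z x y : vle (x + z) (y + z) <-> vle x y.
Proof.
split; last exact: vleD.
by move=> /(vleD (- z)); rewrite !addrK.
Qed.

Lemma vle_sub x y : vle x y <-> vle 0 (y - x).
Proof. by rewrite -(vle_add2r (- x)) subrr. Qed.

Lemma vle_subLR x y z : vle (x - y) z <-> vle x (z + y).
Proof. by rewrite -(vle_add2r y) subrK. Qed.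

Lemma vleN x y : vle (- x) (- y) <-> vle y x.
Proof. by rewrite vle_sub opprK addrC -vle_sub. Qed.

Lemma vle_add x y z t : vle x y -> vle z t -> vle (x + z) (y + t).
Proof.
move=> xy zt; apply: (vle_trans (y + z)); first exact: vleD.
by rewrite ![y + _]addrC; exact: vleD.
Qed.

Lemma vle_scale a x y : 0 <= a -> vle x y -> vle (a *: x) (a *: y).
Proof.
by move=> a0 /vle_sub xy; apply/vle_sub; rewrite -scalerBr; exact: vleZ.
Qed.

Lemma vle_scale_pos a x y : 0 < a -> vle (a *: x) (a *: y) <-> vle x y.
Proof.
move=> a0; split; last exact/vle_scale/ltW.
move=> /(@vle_scale a^-1 _ _ (ltW _)); rewrite invr_gt0 => /(_ a0).
by rewrite !scalerA mulVf ?gt_eqF// !scale1r.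
Qed.

Lemma vle_sum (I : Type) (r : seq I) (f g : I -> X) :
  (forall i, vle (f i) (g i)) -> vle (\sum_(i <- r) f i) (\sum_(i <- r) g i).
Proof.
move=> fg; elim: r => [|i r IH]; first by rewrite !big_nil; exact: vle_refl.
by rewrite !big_cons; exact: vle_add.
Qed.

Lemma vjoinDr x y z : vjoin (x + z) (y + z) = vjoin x y + z.
Proof.
by apply: vle_anti_iff => t; rewrite vjoin_lub -[t](subrK z) !vle_add2r vjoin_lub.
Qed.

Lemma vjoinDl x y z : vjoin (z + x) (z + y) = z + vjoin x y.
Proof. by rewrite ![z + _]addrC vjoinDr. Qed.

Lemma vjoin_scale a x y : 0 <= a -> vjoin (a *: x) (a *: y) = a *: vjoin x y.
Proof.
rewrite le_eqVlt => /predU1P[<-|a0].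
  by rewrite !scale0r; apply/vjoin_idPl/vle_refl.
apply: vle_anti_iff => t.
have -> : t = a *: (a^-1 *: t) by rewrite scalerA divff ?scale1r ?gt_eqF.
by rewrite vjoin_lub !vle_scale_pos// vjoin_lub.
Qed.

Lemma vmeetE x y : vmeet x y = - vjoin (- x) (- y).
Proof.
apply: vle_anti.
- rewrite -vleN opprK; apply/vjoin_lub; rewrite !vleN.
  exact/vmeet_glb/vle_refl.
- by apply/vmeet_glb; split; rewrite -vleN opprK;
    [exact: vle_joinl|exact: vle_joinr].
Qed.

Lemma vabs_le x y : vle (vabs x) y <-> vle x y /\ vle (- x) y.
Proof. exact: vjoin_lub. Qed.

Lemma vle_abs x : vle x (vabs x). Proof. exact: vle_joinl. Qed.

Lemma vle_absN x : vle (- x) (vabs x). Proof. exact: vle_joinr. Qed.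

Lemma vabsN x : vabs (- x) = vabs x.
Proof. by rewrite /vabs opprK vjoinC. Qed.

Lemma vabs_ge0 x : vle 0 (vabs x).
Proof.
apply/(vle_scale_pos _ _ (ltr0n _ 2)); rewrite scaler0 scaler_nat mulr2n.
by rewrite -(subrr x); exact: vle_add (vle_abs x) (vle_absN x).
Qed.

Lemma ger0_vabs x : vle 0 x -> vabs x = x.
Proof.
move=> x0; rewrite /vabs vjoinC; apply/vjoin_idPl.
have : vle (- x) 0 by rewrite -oppr0 vleN.
by move=> /vle_trans; exact.
Qed.

Lemma vabs_id x : vabs (vabs x) = vabs x.
Proof. by apply: ger0_vabs; exact: vabs_ge0. Qed.

Lemma vabsB x y : vabs (x - y) = vabs (y - x).
Proof. by rewrite -vabsN opprB. Qed.

Lemma vabsZ_ge0 a x : 0 <= a -> vabs (a *: x) = a *: vabs x.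
Proof. by move=> a0; rewrite /vabs -scalerN vjoin_scale. Qed.

Lemma vabs_join x y x' y' :
  vle (vabs (vjoin x y - vjoin x' y')) (vabs (x - x') + vabs (y - y')).
Proof.
have half (u v u' v' : X) :
    vle (vjoin u v - vjoin u' v') (vabs (u - u') + vabs (v - v')).
  apply/vle_subLR/vjoin_lub; split.
    have /vle_subLR h := vle_abs (u - u').
    apply: vle_trans h _; apply: vle_add (vle_joinl _ _).
    by rewrite -{1}[vabs _]addr0; exact: vle_add (vle_refl _) (vabs_ge0 _).
  have /vle_subLR h := vle_abs (v - v').
  apply: vle_trans h _; apply: vle_add (vle_joinr _ _).
  by rewrite -{1}[vabs (v - v')]add0r; exact: vle_add (vabs_ge0 _) (vle_refl _).
apply/vabs_le; split; first exact: half.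
by rewrite opprB (vabsB x) (vabsB y); exact: half.
Qed.

End VectorLatticeTheory.

(** The axioms of a vector lattice as equations in the join alone. In this form
    they pass at once to functions, to subspaces and to quotients. *)
HB.factory Record Lmodule_hasJoin (R : realType) X of GRing.Lmodule R X := {
  join : X -> X -> X ;
  joinC : commutative join ;
  joinA : associative join ;
  joinxx : idempotent_op join ;
  joinDr : forall x y z, join (x + z) (y + z) = join x y + z ;
  joinZ : forall (a : R) x y, 0 <= a -> join (a *: x) (a *: y) = a *: join x y
}.

HB.builders Context (R : realType) X of Lmodule_hasJoin R X.

Let le x y := join x y = y.
Let meet x y := - join (- x) (- y).

Fact le_refl x : le x x. Proof. exact: joinxx. Qed.

Fact le_anti x y : le x y -> le y x -> x = y.
Proof. by rewrite /le joinC => -> ->. Qed.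

Fact le_trans y x z : le x y -> le y z -> le x z.
Proof. by rewrite /le => xy <-; rewrite joinA xy. Qed.

Fact join_lub x y z : le (join x y) z <-> le x z /\ le y z.
Proof.
rewrite /le; split=> [<-|[xz yz]]; last by rewrite -joinA yz.
by rewrite !joinA joinxx [join y x]joinC -[join (join x y) y]joinA joinxx.
Qed.

Fact le_add z x y : le x y -> le (x + z) (y + z).
Proof. by rewrite /le joinDr => ->. Qed.

Fact le_opp x y : le (- x) (- y) <-> le y x.
Proof.
have e : - y + (x + y) = x by rewrite [x + y]addrC addKr.
split=> [/(@le_add (x + y))|/(@le_add (- (x + y)))]; first by rewrite addKr e.
have -> : y - (x + y) = - x by rewrite opprD addrC subrK.
by rewrite opprD addrA subrr add0r.
Qed.

Fact meet_glb x y z : le z (meet x y) <-> le z x /\ le z y.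
Proof. by rewrite -le_opp opprK join_lub !le_opp. Qed.

Fact le_scale (a : R) x : 0 <= a -> le 0 x -> le 0 (a *: x).
Proof. by rewrite /le => a0 x0; rewrite -{1}(scaler0 _ a) joinZ// x0. Qed.

HB.instance Definition _ := Lmodule_isVectorLattice.Build R X
  le_refl le_anti le_trans join_lub meet_glb le_add le_scale.

HB.end.

Section RealLine.
Variable R : realType.

Fact maxo_scale (a : R) (x y : R^o) :
  0 <= a -> Num.max (a *: x) (a *: y) = a *: Num.max x y :> R^o.
Proof. by move=> a0; rewrite /GRing.scale/= -maxr_pMr. Qed.

HB.instance Definition _ := Lmodule_hasJoin.Build R R^o
  (@maxC _ _) (@maxA _ _) (@maxxx _ _) (fun x y z => esym (addr_maxl x y z)) maxo_scale.

Lemma vle_realE (x y : R^o) : vle x y <-> x <= y.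
Proof. by split=> /max_idPr. Qed.

Lemma vjoin_realE (x y : R^o) : vjoin x y = Num.max x y. Proof. by []. Qed.

Lemma vabs_realE (x : R^o) : vabs x = `|x|.
Proof.
rewrite /vabs vjoin_realE; have [x0|x0] := leP 0 x.
  by rewrite ger0_norm// max_l//; rewrite (le_trans _ x0)// oppr_le0.
by rewrite ltr0_norm// max_r// (le_trans (ltW x0))// oppr_ge0 ltW.
Qed.

End RealLine.

Section FunctionLattice.
Variables (R : realType) (T : Type) (X : vectorLatticeType R).

Definition fun_join (f g : T -> X) : T -> X := fun t => vjoin (f t) (g t).

Fact fun_joinC : commutative fun_join.
Proof. by move=> f g; apply/funext => t; exact: vjoinC. Qed.

Fact fun_joinA : associative fun_join.
Proof. by move=> f g h; apply/funext => t; exact: vjoinA. Qed.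

Fact fun_joinxx : idempotent_op fun_join.
Proof. by move=> f; apply/funext => t; exact: vjoinxx. Qed.

Fact fun_joinDr (f g h : T -> X) :
  fun_join (f + h) (g + h) = fun_join f g + h.
Proof. by apply/funext => t; exact: vjoinDr. Qed.

Fact fun_joinZ (a : R) (f g : T -> X) :
  0 <= a -> fun_join (a *: f) (a *: g) = a *: fun_join f g.
Proof. by move=> a0; apply/funext => t; exact: vjoin_scale. Qed.

HB.instance Definition _ := Lmodule_hasJoin.Build R (T -> X)
  fun_joinC fun_joinA fun_joinxx fun_joinDr fun_joinZ.

End FunctionLattice.

(** * Linear functionals on a real vector space *)

Section LinearFunctionals.
Variables (R : realType) (E : lmodType R).
Implicit Types (x y v : E) (phi psi : {linear E -> R^o}).

Lemma linear_bundle (X : lmodType R) (f : E -> X) :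
  linear f -> exists g : {linear E -> X}, g = f :> (E -> X).
Proof.
move=> lf; pose L := GRing.isLinear.Build R E X *:%R f lf.
by pose g : {linear E -> X} := HB.pack f L; exists g.
Qed.

Lemma functional_comb phi psi (a : R) :
  exists chi : {linear E -> R^o}, forall x, chi x = phi x + a * psi x.
Proof.
have [|chi chiE] := @linear_bundle R^o (fun x => phi x + a * psi x : R^o).
  move=> b x y; rewrite !linearP /= /GRing.scale /=; ring.
by exists chi => x; rewrite chiE.
Qed.

(** A subspace maximal among those that avoid [v], given by Zorn's lemma, is a
    hyperplane; the functional is the coordinate along [v]. *)
Lemma functional_separation v : v != 0 ->
  exists phi : {linear E -> R^o}, phi v = 1.
Proof.
move=> v0.
pose P (W : set E) := (forall (a : R) x y, W x -> W y -> W (a *: x + y)) /\ ~ W v.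
have [|W [[Wlin Wv] Wmax]] := @Zorn_bigcup E P.
  move=> F FP Ftot; split=> [a x y [A FA Ax] [B FB By]|[A /FP[_ +]//]].
  have [AB|BA] := Ftot _ _ FA FB.
    by exists B => //; apply: (FP _ FB).1 => //; exact: AB.
  by exists A => //; apply: (FP _ FA).1 => //; exact: BA.
have W0 : W 0.
  apply: contrapT => nW0; apply: (Wmax [set 0]); last first.
    by split=> [a _ _ -> ->|/eqP]; [rewrite /= scaler0 addr0|rewrite (negbTE v0)].
  have nW x : ~ W x.
    move=> Wx; apply: nW0; have := Wlin (-1) x x Wx Wx.
    by rewrite scaleN1r addNr.
  by split=> [x /nW//|/(_ 0 erefl)].
have WD x y : W x -> W y -> W (x + y).
  by move=> Wx Wy; rewrite -[x]scale1r; exact: Wlin.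
have WZ a x : W x -> W (a *: x).
  by move=> Wx; rewrite -[_ *: _]addr0; exact: Wlin.
have WB x y : W x -> W y -> W (x - y).
  by move=> Wx Wy; apply: WD => //; rewrite -scaleN1r; exact: WZ.
(* If [x] has no component along [v], then [W] enlarged by [x] still avoids
   [v]. *)
have dec x : exists c, W (x - c *: v).
  apply: contrapT => nc; have nWx : ~ W x.
    by move=> Wx; apply: nc; exists 0; rewrite scale0r subr0.
  apply: (Wmax [set z | exists2 a, W (z - a *: x) & True]).
    split=> [z Wz|/(_ x)]; first by exists 0 => //; rewrite scale0r subr0.
    by move=> h; apply/nWx/h; exists 1 => //; rewrite scale1r subrr.
  split=> [a y z [b Wy _] [c Wz _]|[a Wva _]].
    exists (a * b + c) => //.
    have -> : a *: y + z - (a * b + c) *: x = a *: (y - b *: x) + (z - c *: x).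
      by rewrite scalerBr scalerA scalerDl opprD addrACA.
    exact: Wlin.
  have [a0|a0] := eqVneq a 0.
    by move: Wva; rewrite a0 scale0r subr0.
  apply: nc; exists a^-1; have := WZ (- a^-1) _ Wva.
  by rewrite scalerBr !scaleNr scalerA mulVf// scale1r opprK addrC.
have dec1 x c c' : W (x - c *: v) -> W (x - c' *: v) -> c = c'.
  move=> Wc Wc'; apply/eqP; rewrite -subr_eq0; apply/negPn/negP => cc'.
  apply: Wv; have := WZ (c - c')^-1 _ (WB _ _ Wc' Wc).
  have -> : x - c' *: v - (x - c *: v) = (c - c') *: v.
    by rewrite opprB [LHS]addrC addrA subrK scalerBl.
  by rewrite scalerA mulVf// scale1r.
pose f x : R^o := sval (cid (dec x)).
have fP x : W (x - f x *: v) by rewrite /f; case: cid.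
have [|phi phiE] := @linear_bundle R^o f.
  move=> a x y; apply: dec1 (fP _) _.
  rewrite scalerDl opprD addrACA -scalerA -scalerBr.
  exact: Wlin.
exists phi; rewrite phiE; apply: dec1 (fP _) _.
by rewrite scale1r subrr.
Qed.

Lemma small_perturbation n (a b : 'I_n -> R) : (forall i, 0 < a i) ->
  exists2 eps : R, 0 < eps & forall i, 0 < a i + eps * b i.
Proof.
move=> a0; pose M := 1 + \sum_i `|b i| / a i.
have M0 : 0 < M.
  by rewrite ltr_pwDl// sumr_ge0// => i _; rewrite divr_ge0// ltW.
(* Each [`|b i| / a i] is one of the terms of [M], hence smaller than [M]. *)
exists M^-1 => [|i]; first by rewrite invr_gt0.
have bM : `|b i| / a i < M.
  rewrite /M (bigD1 i)//= addrA addrAC -ltrBlDr subrr ltr_pwDl//.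
  by rewrite sumr_ge0// => j _; rewrite divr_ge0// ltW.
have ai := a0 i; have bn : - `|b i| <= b i by rewrite lerNl -normrN ler_norm.
rewrite -(pmulr_rgt0 _ M0) mulrDr mulVKf ?gt_eqF//.
move: bM; rewrite ltr_pdivrMr// => bM; lra.
Qed.

(** Gordan's alternative, by elimination of the last vector [v]. Start from
    [phi0], positive on the other vectors. If [phi0 v < 0], the other vectors
    are translated along [v] into the kernel of [phi0], and the induction
    hypothesis is applied to the translates; if [phi0 v = 0], a functional
    separating [v] from [0] is added to [phi0] with a small coefficient. *)
Lemma gordan n (e : 'I_n -> E) :
  (exists phi : {linear E -> R^o}, forall i, 0 < phi (e i)) \/
  (exists c : 'I_n -> R, [/\ forall i, 0 <= c i, exists i, 0 < c i &
     \sum_i c i *: e i = 0]).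
Proof.
elim: n e => [|n IH] e.
  left; have [|phi _] := @linear_bundle R^o (fun=> 0).
    by move=> a x y; rewrite scaler0 addr0.
  by exists phi => -[].
pose wi (i : 'I_n) : 'I_n.+1 := widen_ord (leqnSn n) i.
pose v := e ord_max.
have split_ord (P : 'I_n.+1 -> Prop) :
    (forall i, P (wi i)) -> P ord_max -> forall i, P i.
  move=> Pw Pm i; have [ilt|ige] := ltnP i n.
    by have -> : i = wi (Ordinal ilt) by exact/val_inj.
  suff -> : i = ord_max by [].
  by apply/val_inj/eqP; rewrite eqn_leq ige -ltnS ltn_ord.
pose ext (c : 'I_n -> R) (a : R) (i : 'I_n.+1) :=
  if insub (val i) is Some j then c j else a.
have extw c a i : ext c a (wi i) = c i by rewrite /ext /= valK.
have extm c a : ext c a ord_max = a by rewrite /ext /= insubF// ltnn.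
have [[phi0 phi0P]|[c [c0 [j cj] ce]]] := IH (e \o wi); last first.
  right; exists (ext c 0); split.
  - by apply: split_ord => [i|]; rewrite ?extw// extm.
  - by exists (wi j); rewrite extw.
  - rewrite big_ord_recr/= extm scale0r addr0 -[RHS]ce.
    by apply: eq_bigr => i _; rewrite extw.
have perturb (psi chi : {linear E -> R^o}) : (forall i, 0 < psi (e (wi i))) ->
    psi v = 0 -> 0 < chi v ->
    exists phi : {linear E -> R^o}, forall i, 0 < phi (e i).
  move=> psi0 psiv chiv.
  have [eps eps0 epsP] := small_perturbation (fun i => chi (e (wi i))) psi0.
  have [phi phiE] := functional_comb psi chi eps.
  exists phi; apply: split_ord => [i|]; rewrite phiE//.
  by rewrite psiv add0r mulr_gt0.
have [v0|v0|v0] := ltrgtP (phi0 v) 0; last first.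
- have [vE|vn0] := eqVneq v 0.
    right; exists (ext (fun=> 0) 1); split.
    + by apply: split_ord => [i|]; rewrite ?extw// extm.
    + by exists ord_max; rewrite extm.
    + rewrite big_ord_recr/= extm scale1r big1 ?add0r// => i _.
      by rewrite extw scale0r.
  have [chi chiv] := functional_separation vn0.
  by left; apply: (perturb phi0 chi) => //; rewrite chiv.
- by left; exists phi0; exact: split_ord.
pose r i := - (phi0 (e (wi i)) / phi0 v).
have r0 i : 0 < r i.
  by rewrite /r -mulrN -invrN divr_gt0 ?oppr_gt0//; exact: phi0P.
(* [r i] is chosen so that [phi0] vanishes at [e i + r i *: v]; since it is
   positive, a nonnegative relation between these vectors is one between the
   original vectors. *)
have [[phi1 phi1P]|[c [c0 [j cj] ce]]] := IH (fun i => e (wi i) + r i *: v).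
  (* [psi] vanishes at [v] and agrees with [phi1] on the translates. *)
  have [psi psiE] := functional_comb phi1 phi0 (- (phi1 v / phi0 v)).
  have [mphi0 mphi0E] := functional_comb psi phi0 (-1).
  left; apply: (perturb psi mphi0).
  - move=> i; rewrite psiE; have := phi1P i; rewrite linearD linearZ /=.
    rewrite /r /GRing.scale /=; congr (_ < _ + _); field; exact: ltr0_neq0.
  - by rewrite psiE; field; exact: ltr0_neq0.
  - have psiv : psi v = 0 by rewrite psiE; field; exact: ltr0_neq0.
    by rewrite mphi0E psiv add0r mulN1r oppr_gt0.
right; exists (ext c (\sum_i c i * r i)); split.
- apply: split_ord => [i|]; first by rewrite extw.
  by rewrite extm sumr_ge0// => i _; rewrite mulr_ge0// ltW.
- by exists (wi j); rewrite extw.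
- rewrite big_ord_recr/= extm scaler_suml -big_split/= -[RHS]ce.
  by apply: eq_bigr => i _; rewrite extw scalerDr scalerA.
Qed.

End LinearFunctionals.

(** * Lattice-linear words *)

Section MaxZero.
Context {R : realType} {X : vectorLatticeType R}.
Implicit Types (x y z : X) (s : seq X).

(** Including [0] in every maximum makes sense of the empty family. It loses no
    generality, since [x] is the difference of [vjoin 0 x] and
    [vjoin 0 (- x)]. *)
Definition vmax0 s : X := foldr vjoin 0 s.

Lemma vmax0_le s z : vle (vmax0 s) z <-> (forall x, x \in 0 :: s -> vle x z).
Proof.
elim: s => [|y s IH] /=.
  split=> [z0 x|h]; last by apply: h; rewrite mem_head.
  by rewrite inE => /eqP->.
rewrite vjoin_lub IH; split=> [[yz h] x|h].
  rewrite !inE => /or3P[/eqP->|/eqP->//|xs]; apply: h; rewrite inE ?eqxx//.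
  by rewrite xs orbT.
split=> [|x]; first by apply: h; rewrite !inE eqxx orbT.
by rewrite inE => /orP[x0|xs]; apply: h; rewrite !inE ?x0// xs !orbT.
Qed.

Lemma vle_max0 s x : x \in 0 :: s -> vle x (vmax0 s).
Proof. exact/((vmax0_le s _).1 (vle_refl _)). Qed.

Lemma vmax0_ge0 s : vle 0 (vmax0 s).
Proof. by apply: vle_max0; rewrite mem_head. Qed.

Lemma vmax0_cat s s' : vmax0 (s ++ s') = vjoin (vmax0 s) (vmax0 s').
Proof.
elim: s => [|x s IH] /=; last by rewrite IH vjoinA.
by apply/esym/vjoin_idPl/vmax0_ge0.
Qed.

Lemma vmax0_scale (a : R) s : 0 <= a ->
  vmax0 [seq a *: x | x <- s] = a *: vmax0 s.
Proof.
move=> a0; elim: s => [|x s IH] /=; first by rewrite scaler0.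
by rewrite IH vjoin_scale.
Qed.

End MaxZero.

Definition psum (E : zmodType) (s s' : seq E) : seq E :=
  [seq x + y | x <- 0 :: s, y <- 0 :: s'].

(** The sum of two maxima is the maximum of the pairwise sums, because
    translations preserve order. *)
Lemma vmax0_psum (R : realType) (X : vectorLatticeType R) (s s' : seq X) :
  vmax0 (psum s s') = vmax0 s + vmax0 s'.
Proof.
apply: vle_anti_iff => z; split=> h.
  rewrite -[z](subrK (vmax0 s')) vle_add2r; apply/vmax0_le => x xs.
  rewrite -(vle_add2r (vmax0 s')) subrK addrC -[x]opprK vle_subLR.
  apply/vmax0_le => y ys; rewrite -vle_subLR opprK addrC.
  apply: ((vmax0_le _ _).1 h); rewrite inE; apply/orP; right.
  exact: allpairs_f.
apply/vmax0_le => u; rewrite inE => /predU1P[->|/allpairsP[[x y] /= [xs ys ->]]];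
  apply: vle_trans h.
  by rewrite -[X in vle X _]addr0; apply: vle_add; exact: vmax0_ge0.
by apply: vle_add; exact: vle_max0.
Qed.

(** A word [(s1, s2)] stands for the difference of the maximum of [0 :: s1] and
    that of [0 :: s2]. All lattice-linear expressions can be brought to this
    form without the distributive law: [a - b] joined with [c - d] is
    [a + d] joined with [c + b], minus [b + d]. *)
Definition word (E : Type) : Type := seq E * seq E.

Section Words.
Variables (R : realType) (E : lmodType R).
Implicit Types w : word E.

Definition word_eval (X : vectorLatticeType R) (T : E -> X) w : X :=
  vmax0 (map T w.1) - vmax0 (map T w.2).

Definition word_var (e : E) : word E := ([:: e], [:: - e]).

Definition word_add w w' : word E := (psum w.1 w'.1, psum w.2 w'.2).

Definition word_scale (a : R) w : word E :=
  if 0 <= a then (map ( *:%R a) w.1, map ( *:%R a) w.2)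
  else (map ( *:%R (- a)) w.2, map ( *:%R (- a)) w.1).

Definition word_join w w' : word E :=
  (psum w.1 w'.2 ++ psum w'.1 w.2, psum w.2 w'.2).

Section Eval.
Variables (X : vectorLatticeType R) (T : {linear E -> X}).

Lemma map_psum (s s' : seq E) : map T (psum s s') = psum (map T s) (map T s').
Proof.
rewrite /psum -(raddf0 T) -!map_cons map_allpairs [RHS]allpairs_mapl.
rewrite allpairs_mapr.
by apply: eq_allpairs => x y; rewrite raddfD.
Qed.

Lemma map_scale (a : R) (s : seq E) :
  map T (map ( *:%R a) s) = map ( *:%R a) (map T s).
Proof. by rewrite -!map_comp; apply: eq_map => x /=; rewrite linearZ. Qed.

Lemma word_eval_var e : word_eval T (word_var e) = T e.
Proof.
rewrite /word_eval /= raddfN; apply/eqP.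
by rewrite subr_eq -vjoinDl subrr addr0 vjoinC.
Qed.

Lemma word_eval_add w w' :
  word_eval T (word_add w w') = word_eval T w + word_eval T w'.
Proof. by rewrite /word_eval !map_psum !vmax0_psum opprD addrACA. Qed.

Lemma word_eval_scale a w : word_eval T (word_scale a w) = a *: word_eval T w.
Proof.
rewrite /word_eval /word_scale; case: (leP 0 a) => a0.
  by rewrite !map_scale !vmax0_scale// scalerBr.
rewrite !map_scale !vmax0_scale ?oppr_ge0 ?(ltW a0)//.
by rewrite -scalerBr scaleNr -scalerN opprB.
Qed.

Lemma word_eval_join w w' :
  word_eval T (word_join w w') = vjoin (word_eval T w) (word_eval T w').
Proof.
rewrite /word_eval map_cat vmax0_cat !map_psum !vmax0_psum -vjoinDr.
congr vjoin; first by rewrite opprD addrACA subrr addr0.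
by rewrite opprD addrA addrK.
Qed.

(** The word [(s1, s2)] is nonnegative when each [y] of [s2] lies below the
    maximum of [0 :: s1]. When this holds at every real functional, no
    functional is positive at all differences [y - x], with [x] in [0 :: s1];
    so [gordan] exhibits [y] as a convex combination of [0 :: s1], an identity
    that [T] preserves. *)
Lemma word_transfer w :
  (forall phi : {linear E -> R^o}, 0 <= word_eval phi w) ->
  vle 0 (word_eval T w).
Proof.
case: w => s1 s2 /= w0; rewrite /word_eval -vle_sub /=.
apply/vmax0_le => _ /predU1P[->|/mapP[y ys ->]]; first exact: vmax0_ge0.
pose e (i : 'I_(size (0 :: s1))) := y - nth 0 (0 :: s1) i.
have [[phi phiP]|[c [c0 [j cj] ce]]] := gordan e.
  exfalso; have := w0 phi; rewrite /word_eval subr_ge0 leNgt => /negP; apply.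
  have : (vmax0 (map phi s1) : R) < phi y.
    have lt x : x \in 0 :: s1 -> (phi x : R) < phi y.
      move=> xs; have xi : (index x (0%R :: s1) < size (0%R :: s1))%N.
        by rewrite index_mem.
      have := phiP (Ordinal xi); rewrite /e.
      by rewrite [nth _ _ _](nth_index (0 : E) xs) raddfB subr_gt0.
    elim: s1 lt {w0 e phiP} => [|x s IH] lt /=.
      by rewrite -(raddf0 phi) lt ?mem_head.
    rewrite vjoin_realE gt_max lt ?IH ?inE ?eqxx ?orbT// => z zs.
    by apply: lt; move: zs; rewrite !inE => /orP[->//|->]; rewrite !orbT.
  move=> /lt_le_trans; apply; apply/vle_realE/vle_max0.
  by rewrite inE map_f ?orbT.
have C0 : 0 < \sum_i c i.
  by rewrite (bigD1 j)//= ltr_pwDl// sumr_ge0.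
apply/(vle_scale_pos _ _ C0).
have : (\sum_i c i) *: T y = \sum_i c i *: T (nth 0 (0 :: s1) i).
  have e0 : T (\sum_i c i *: e i) = 0 by rewrite ce raddf0.
  apply/eqP; rewrite -subr_eq0 scaler_suml -sumrB -[X in _ == X]e0 raddf_sum.
  by apply/eqP/eq_bigr => i _; rewrite [RHS]linearZ /= -scalerBr -raddfB.
move=> ->; rewrite scaler_suml; apply: vle_sum => i.
apply: vle_scale => //; apply: vle_max0.
have -> : 0 :: map T s1 = map T (0 :: s1) by rewrite /= raddf0.
by apply/map_f/mem_nth.
Qed.

End Eval.

(** Used for coordinate projections, evaluations at a functional and
    projections onto quotients. *)
Lemma word_eval_hom (X Y : vectorLatticeType R) (g : {linear X -> Y}) (T : E -> X) w :
  (forall x y, g (vjoin x y) = vjoin (g x) (g y)) ->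
  g (word_eval T w) = word_eval (g \o T) w.
Proof.
move=> gj; rewrite /word_eval [LHS]raddfB /=.
suff h s : g (vmax0 (map T s)) = vmax0 (map (g \o T) s) by rewrite !h.
by elim: s => [|x s IH] /=; rewrite ?raddf0// gj IH.
Qed.

Lemma eq_word_eval (X : vectorLatticeType R) (T T' : E -> X) w :
  T =1 T' -> word_eval T w = word_eval T' w.
Proof. by move=> TT'; rewrite /word_eval !(eq_map TT'). Qed.

Definition word_opp w : word E := (w.2, w.1).

Lemma word_eval_opp (X : vectorLatticeType R) (T : E -> X) w :
  word_eval T (word_opp w) = - word_eval T w.
Proof. by rewrite /word_eval opprB. Qed.

Lemma word_transfer_le (X : vectorLatticeType R) (T : {linear E -> X}) w w' :
  (forall phi : {linear E -> R^o}, word_eval phi w <= word_eval phi w' :> R) ->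
  vle (word_eval T w) (word_eval T w').
Proof.
move=> ww'; rewrite vle_sub -word_eval_opp -word_eval_add.
apply: word_transfer => phi; rewrite word_eval_add word_eval_opp.
by rewrite subr_ge0.
Qed.

Lemma word_transfer_eq (X : vectorLatticeType R) (T : {linear E -> X}) w w' :
  (forall phi : {linear E -> R^o}, word_eval phi w = word_eval phi w') ->
  word_eval T w = word_eval T w'.
Proof.
by move=> ww'; apply: vle_anti; apply: word_transfer_le => phi; rewrite ww'.
Qed.

End Words.

Section WordOperations.
Variables (R : realType) (E : lmodType R).

Definition word_abs (w : word E) : word E := word_join w (word_opp w).

Definition word_l1 (s : seq E) : word E :=
  foldr (fun e => word_add (word_abs (word_var e))) ([::], [::]) s.

Lemma word_eval_abs (X : vectorLatticeType R) (T : {linear E -> X}) w :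
  word_eval T (word_abs w) = vabs (word_eval T w).
Proof. by rewrite word_eval_join word_eval_opp. Qed.

Lemma word_eval_l1 (X : vectorLatticeType R) (T : {linear E -> X}) s :
  word_eval T (word_l1 s) = \sum_(e <- s) vabs (T e).
Proof.
elim: s => [|e s IH]; first by rewrite big_nil /word_eval /= subrr.
by rewrite big_cons /= word_eval_add IH word_eval_abs word_eval_var.
Qed.

Lemma word_transfer_abs (X : vectorLatticeType R) (T : {linear E -> X}) w w' :
  (forall phi : {linear E -> R^o}, `|word_eval phi w| <= word_eval phi w' :> R) ->
  vle (vabs (word_eval T w)) (word_eval T w').
Proof.
move=> ww'; rewrite -word_eval_abs; apply: word_transfer_le => phi.
by rewrite word_eval_abs vabs_realE.
Qed.

Definition word_map (E' : Type) (g : E' -> E) (w : word E') : word E :=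
  (map g w.1, map g w.2).

Lemma word_eval_map (E' : lmodType R) (g : E' -> E) (X : vectorLatticeType R) (T : E -> X) w :
  word_eval T (word_map g w) = word_eval (T \o g) w.
Proof. by rewrite /word_eval /= -!map_comp. Qed.

End WordOperations.

(** * Approximation of positively homogeneous functions by words *)

Section Lincomb.
Context {R : realType} {X : lmodType R} {n : nat}.

Definition lincomb (x : 'I_n -> X) (c : 'rV[R]_n) : X := \sum_k c ord0 k *: x k.

Lemma lincomb_is_linear x : linear (lincomb x).
Proof.
move=> a c d; rewrite /lincomb scaler_sumr -big_split/=.
by apply: eq_bigr => k _; rewrite !mxE scalerDl scalerA.
Qed.

HB.instance Definition _ x :=
  GRing.isLinear.Build R 'rV[R]_n X *:%R (lincomb x) (lincomb_is_linear x).

Lemma lincomb_delta x k : lincomb x (delta_mx ord0 k) = x k.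
Proof.
rewrite /lincomb (bigD1 k)//= mxE !eqxx scale1r big1 ?addr0// => j jk.
by rewrite mxE (negbTE jk) andbF scale0r.
Qed.

Lemma lincombE (T : {linear 'rV[R]_n -> X}) :
  T =1 lincomb (fun k => T (delta_mx ord0 k)).
Proof.
move=> c; rewrite {1}(row_sum_delta c) [LHS]linear_sum.
by apply: eq_bigr => k _; rewrite linearZ_LR.
Qed.

End Lincomb.

Lemma continuous_lin (R : realType) (T : topologicalType) (a : R) (g h : T -> R) x :
  {for x, continuous g} -> {for x, continuous h} ->
  {for x, continuous (fun t => a * g t + h t)}.
Proof.
move=> gc hc; apply: cvgD; last exact: hc.
by apply: cvgM; [exact: cvg_cst|exact: gc].
Qed.

Section Hcone.
Variables (R : realType) (n : nat).
Implicit Types (g h : 'rV[R]_n -> R) (t : 'rV[R]_n).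

Lemma Hcone_coord k : Hcone (fun t : 'rV[R]_n => t ord0 k).
Proof.
by split=> [|a t _]; [exact: coord_continuous|rewrite mxE].
Qed.

Lemma Hcone_lin (a : R) g h :
  Hcone g -> Hcone h -> Hcone (fun t => a * g t + h t).
Proof.
move=> [gc gh] [hc hh]; split=> [t|b t b0]; last by rewrite gh// hh//; ring.
exact: (@continuous_lin R 'rV[R]_n a g h t (gc t) (hc t)).
Qed.

Lemma Hcone0 : Hcone (fun _ : 'rV[R]_n => 0).
Proof. by split=> [t|b t b0]; [exact: cst_continuous|rewrite mulr0]. Qed.

Lemma Hcone_scale (a : R) g : Hcone g -> Hcone (fun t => a * g t).
Proof.
move=> gH; have := Hcone_lin a gH Hcone0.
by congr Hcone; apply/funext => t; rewrite addr0.
Qed.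

Lemma Hcone_max g h : Hcone g -> Hcone h -> Hcone (fun t => Num.max (g t) (h t)).
Proof.
move=> [gc gh] [hc hh]; split=> [t|b t b0]; last by rewrite gh// hh// maxr_pMr.
exact: (@continuous_max R 'rV[R]_n g h t (gc t) (hc t)).
Qed.

Lemma Hcone_sum (I : Type) (r : seq I) (f : I -> 'rV[R]_n -> R) :
  (forall i, Hcone (f i)) -> Hcone (fun t => \sum_(i <- r) f i t).
Proof.
move=> fH; elim: r => [|i r IH].
  by have := Hcone0; congr Hcone; apply/funext => t; rewrite big_nil.
have := Hcone_lin 1 (fH i) IH.
by congr Hcone; apply/funext => t; rewrite big_cons mul1r.
Qed.

Lemma Hcone_lincomb (c : 'rV[R]_n) :
  Hcone (fun t => lincomb (fun k => t ord0 k : R^o) c).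
Proof.
by apply: Hcone_sum => k; exact: Hcone_scale (Hcone_coord k).
Qed.

Lemma Hcone_vmax0 (s : seq 'rV[R]_n) :
  Hcone (fun t => vmax0 (map (lincomb (fun k => t ord0 k : R^o)) s)).
Proof.
elim: s => [|c s IH] /=; first exact: Hcone0.
exact: Hcone_max (Hcone_lincomb c) IH.
Qed.

Definition word_fun (w : word 'rV[R]_n) t : R :=
  word_eval (lincomb (fun k => t ord0 k : R^o)) w.

Lemma Hcone_word w : Hcone (word_fun w).
Proof.
have := Hcone_lin (-1) (Hcone_vmax0 w.2) (Hcone_vmax0 w.1).
by congr Hcone; apply/funext => t; rewrite mulN1r addrC.
Qed.

Definition l1norm t : R := \sum_k `|t ord0 k|.

Definition is_word_fun h := exists w, word_fun w = h.

Lemma is_word_fun_coord k : is_word_fun (fun t => t ord0 k).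
Proof.
exists (word_var (delta_mx ord0 k)); apply/funext => t.
by rewrite /word_fun word_eval_var /= lincomb_delta.
Qed.

Lemma is_word_fun_scale (a : R) g : is_word_fun g -> is_word_fun (fun t => a * g t).
Proof.
move=> [w <-]; exists (word_scale a w); apply/funext => t.
by rewrite /word_fun word_eval_scale.
Qed.

Lemma is_word_fun_add g h :
  is_word_fun g -> is_word_fun h -> is_word_fun (fun t => g t + h t).
Proof.
move=> [w <-] [w' <-]; exists (word_add w w'); apply/funext => t.
by rewrite /word_fun word_eval_add.
Qed.

Lemma is_word_fun_max g h :
  is_word_fun g -> is_word_fun h -> is_word_fun (fun t => Num.max (g t) (h t)).
Proof.
move=> [w <-] [w' <-]; exists (word_join w w'); apply/funext => t.
by rewrite /word_fun word_eval_join.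
Qed.

Lemma is_word_fun_norm g : is_word_fun g -> is_word_fun (fun t => `|g t|).
Proof.
move=> gw; have := is_word_fun_max gw (is_word_fun_scale (-1) gw).
congr is_word_fun; apply/funext => t.
by rewrite -vabs_realE /vabs mulN1r.
Qed.

Lemma is_word_fun_sum (I : Type) (r : seq I) (f : I -> 'rV[R]_n -> R) :
  (forall i, is_word_fun (f i)) -> is_word_fun (fun t => \sum_(i <- r) f i t).
Proof.
move=> fw; elim: r => [|i r IH].
  exists ([::], [::]); apply/funext => t.
  by rewrite big_nil /word_fun /word_eval /= subrr.
have := is_word_fun_add (fw i) IH.
by congr is_word_fun; apply/funext => t; rewrite big_cons.
Qed.

Lemma is_word_fun_l1norm : is_word_fun l1norm.
Proof. by apply: is_word_fun_sum => k; exact/is_word_fun_norm/is_word_fun_coord. Qed.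

Lemma is_word_fun_Hcone g : is_word_fun g -> Hcone g.
Proof. by move=> [w <-]; exact: Hcone_word. Qed.

Lemma l1norm_ge0 t : 0 <= l1norm t.
Proof. exact: sumr_ge0. Qed.

Lemma l1norm_eq0 t : l1norm t = 0 -> t = 0.
Proof.
move=> /eqP; rewrite psumr_eq0// => /allP t0; apply/rowP => k; rewrite mxE.
by apply/eqP; rewrite -normr_eq0; apply: (t0 k); rewrite mem_index_enum.
Qed.

Lemma norm_le_l1norm t : `|t| <= l1norm t.
Proof.
rewrite [leLHS]/Num.norm /= mx_normrE; apply/bigmax_leP; split=> [|[i k] _] /=.
  exact: l1norm_ge0.
rewrite ord1 /l1norm (bigD1 k)//= lerDl; exact: sumr_ge0.
Qed.

Let sphere : set 'rV[R]_n := [set t | l1norm t = 1].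

Lemma compact_sphere : compact sphere.
Proof.
apply: bounded_closed_compact.
  exists 1; split=> // M M1 t /= t1.
  by rewrite (le_trans (norm_le_l1norm t))// t1 ltW.
have [cl _] := is_word_fun_Hcone is_word_fun_l1norm.
have -> : sphere = l1norm @^-1` [set x | x = 1] by [].
by apply: closed_comp => [t _|]; [exact: cl|exact: closed_eq].
Qed.

(** On the sphere, the l1-distance to [s] is a word function of [u]: it is the
    sum of the [`|u k - l1norm u * s k|]. Near [s] the bound holds by continuity
    of [h]; at distance [d] or more from [s] the slope [(M + M) / d] has made
    the cone drop by at least [M + M]. *)
Lemma cone_below h (M eps : R) (s : 'rV[R]_n) : Hcone h -> 0 < eps ->
  (forall u, sphere u -> `|h u| <= M) -> sphere s ->
  exists g, [/\ is_word_fun g, g s = h s &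
    forall u, sphere u -> g u <= h u + eps].
Proof.
move=> [hc hh] eps0 hM s1.
have [d d0 dP] : exists2 d : R, 0 < d &
    forall u, `|s - u| < d -> `|h s - h u| < eps.
  have /cvgrPdist_lt/(_ _ eps0) := hc s.
  by move=> /nbhs_ballP[d /= d0 dP]; exists d => // u su; apply: dP; rewrite -ball_normE.
pose D (u : 'rV[R]_n) : R := \sum_k `|u ord0 k - l1norm u * s ord0 k|.
pose K : R := (M + M) / d.
have M0 : 0 <= M by apply: le_trans (hM _ s1).
have K0 : 0 <= K by rewrite divr_ge0 ?addr_ge0// ltW.
exists (fun u => h s * l1norm u + (- K) * D u); split.
- apply: is_word_fun_add; apply: is_word_fun_scale; first exact: is_word_fun_l1norm.
  apply: is_word_fun_sum => k; apply: is_word_fun_norm.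
  have := is_word_fun_add (is_word_fun_coord k)
    (is_word_fun_scale (- s ord0 k) is_word_fun_l1norm).
  by congr is_word_fun; apply/funext => t; rewrite mulNr mulrC.
- rewrite [l1norm s]s1 mulr1 /D big1 ?mulr0 ?addr0// => k _.
  by rewrite [l1norm s]s1 mul1r subrr normr0.
move=> u u1; rewrite [l1norm u]u1 mulr1.
have DE : D u = l1norm (u - s).
  by apply: eq_bigr => k _; rewrite [l1norm u]u1 mul1r !mxE.
have [ud|du] := ltP (D u) d.
  have : `|h s - h u| < eps.
    apply: dP; rewrite distrC; apply: le_lt_trans ud.
    by rewrite DE; exact: norm_le_l1norm.
  rewrite ltr_norml => /andP[_ hsu].
  have : 0 <= K * D u by rewrite mulr_ge0// DE l1norm_ge0.
  move: hsu; rewrite mulNr; lra.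
have : M + M <= K * D u.
  by rewrite -[leLHS](@divfK _ d) ?gt_eqF// ler_wpM2l.
have := hM _ s1; have := hM _ u1; rewrite !ler_norml mulNr => /andP[] ? ? /andP[] ? ?.
lra.
Qed.

(** By compactness of the sphere, finitely many of the functions of
    [cone_below] have a maximum within [eps] of [h] on the sphere; homogeneity
    gives the estimate elsewhere. *)
Lemma word_approx h (eps : R) : Hcone h -> 0 < eps ->
  exists w, forall t, `|h t - word_fun w t| <= eps * l1norm t.
Proof.
move=> hH eps0; have [hc hh] := hH.
have [M hM] : exists M, forall u, sphere u -> `|h u| <= M.
  have /compact_bounded[M [_ /(_ (M + 1))]] :
      compact (h @` sphere).
    apply: continuous_compact compact_sphere.
    exact: continuous_subspaceT.
  rewrite ltrDl ltr01 => /(_ isT) hM; exists (M + 1) => u u1.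
  by apply: hM; exists u.
have /choice[g gP] (s : 'rV[R]_n) : exists g, sphere s ->
    [/\ is_word_fun g, g s = h s & forall u, sphere u -> g u <= h u + eps].
  have [s1|ns1] := pselect (sphere s); last by exists h.
  by have [g gP] := cone_below hH eps0 hM s1; exists g.
pose V s := (fun u => g s u - h u) @^-1` [set x | - eps < x].
have Vo s : sphere s -> open (V s).
  move=> /gP[/is_word_fun_Hcone gH _ _].
  apply: open_comp => [u _|]; last exact: open_gt.
  have [+ _] := Hcone_lin (-1) hH gH => /(_ u).
  by congr continuous_at; apply/funext => t; rewrite mulN1r addrC.
have := compact_sphere; rewrite compact_cover => /(_ _ sphere V Vo)[|D Ds Dc].
  move=> s s1; exists s => //; have [_ gs _] := gP _ s1.
  by rewrite /V /= gs subrr oppr_lt0.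
have [k [kw kle kge]] : exists k, [/\ is_word_fun k,
    forall u, sphere u -> k u <= h u + eps &
    forall s, s \in finmap.enum_fset D -> forall u, g s u <= k u].
  have {}Ds s : s \in finmap.enum_fset D -> sphere s by move=> /Ds; rewrite inE.
  elim: (finmap.enum_fset D) Ds => [|s r IH] Ds.
    (* The maximum of no cones: any word function below [h] on the sphere. *)
    exists (fun t => - M * l1norm t); split=> [|u u1|//].
      exact/is_word_fun_scale/is_word_fun_l1norm.
    rewrite [l1norm u]u1 mulr1; have := hM _ u1; rewrite ler_norml => /andP[? _].
    by apply: ler_wpDr => //; exact: ltW.
  have [|k [kw kle kge]] := IH.
    by move=> v vr; apply: Ds; rewrite inE vr orbT.
  have [gw _ gle] := gP s (Ds _ (mem_head _ _)).
  exists (fun t => Num.max (g s t) (k t)); split=> [|u u1|v].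
  - exact: is_word_fun_max.
  - by rewrite ge_max gle// kle.
  - rewrite inE => /predU1P[->|vr] u; first by rewrite le_max lexx.
    by rewrite le_max kge// orbT.
have [w wE] := kw; exists w => t; rewrite wE.
have [t0|t0] := eqVneq (l1norm t) 0.
  rewrite t0 mulr0 (l1norm_eq0 t0).
  have [_ kh] := is_word_fun_Hcone kw.
  by rewrite -(scale0r 0) hh// kh// !mul0r subrr normr0.
have {}t0 : 0 < l1norm t by rewrite lt_neqAle eq_sym t0 l1norm_ge0.
pose u := (l1norm t)^-1 *: t.
have u1 : sphere u.
  have [_ lh] := is_word_fun_Hcone is_word_fun_l1norm.
  by rewrite /sphere /= lh ?mulVf ?gt_eqF// invr_ge0 ltW.
have [_ kh] := is_word_fun_Hcone kw.
have [_ lh] := is_word_fun_Hcone is_word_fun_l1norm.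
suff hku : `|h u - k u| <= eps.
  have -> : t = l1norm t *: u by rewrite scalerA divff ?gt_eqF// scale1r.
  move: (l1norm t) t0 => a /ltW a0; rewrite hh// kh// lh// (u1 : l1norm u = 1).
  by rewrite mulr1 -mulrBr normrM ger0_norm// mulrC ler_wpM2r.
have [s sD Vsu] := Dc u u1.
have := kge s sD u; have := kle u u1; move: Vsu; rewrite /V /= ler_norml => ? ? ?.
by apply/andP; split; lra.
Qed.

End Hcone.

Section WordsOnFamilies.
Variables (R : realType) (X : vectorLatticeType R) (n : nat) (x : 'I_n -> X).

(** Real functionals on row vectors are points of [R^n], so this is the case of
    [word_transfer_abs] where [x] is the image of the canonical basis. *)
Lemma word_fun_transfer (w w' : word 'rV[R]_n) (eps : R) : 0 <= eps ->
  (forall t, `|word_fun w t - word_fun w' t| <= eps * l1norm t) ->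
  vle (vabs (word_eval (lincomb x) w - word_eval (lincomb x) w'))
      (eps *: \sum_k vabs (x k)).
Proof.
move=> eps0 ww'; pose s : seq 'rV[R]_n := [seq eps *: delta_mx ord0 k | k <- enum 'I_n].
have -> : eps *: (\sum_k vabs (x k)) = word_eval (lincomb x) (word_l1 s).
  rewrite word_eval_l1 big_map big_enum scaler_sumr; apply: eq_bigr => k _.
  by rewrite linearZ_LR vabsZ_ge0//= lincomb_delta.
rewrite -word_eval_opp -word_eval_add; apply: word_transfer_abs => phi.
rewrite word_eval_add word_eval_opp word_eval_l1 big_map big_enum.
pose t : 'rV[R]_n := \row_k phi (delta_mx ord0 k).
have phiE w0 : word_eval phi w0 = word_fun w0 t.
  apply: eq_word_eval => c; rewrite lincombE; apply: eq_bigr => k _.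
  by rewrite mxE.
rewrite !phiE; apply: le_trans (ww' t) _; rewrite /l1norm mulr_sumr.
by apply: ler_sum => k _; rewrite mxE linearZ_LR vabsZ_ge0// vabs_realE.
Qed.

End WordsOnFamilies.

(** * Powers and null sequences of real numbers *)

Lemma mul_divD1_le (R : realFieldType) (C eps : R) :
  0 <= C -> 0 <= eps -> C * (eps / (C + 1)) <= eps.
Proof.
move=> C0 eps0; rewrite mulrCA -[leRHS]mulr1 ler_wpM2l//.
by rewrite ler_pdivrMr ?ltr_wpDl// mul1r lerDl.
Qed.

Section Powers.
Variables (R : realType) (p : R).
Hypothesis p_gt0 : 0 < p.
Implicit Types a b : R.

Lemma ler_powR2r a b : 0 <= a -> a <= b -> a `^ p <= b `^ p.
Proof.
move=> a0 ab; apply: ge0_ler_powR; rewrite ?nnegrE//; first exact: ltW.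
exact: le_trans ab.
Qed.

Lemma powR_rootK a : 0 <= a -> (a `^ p^-1) `^ p = a.
Proof. by move=> a0; rewrite -powRrM mulVf ?gt_eqF// powRr1. Qed.

Lemma powR_powK a : 0 <= a -> (a `^ p) `^ p^-1 = a.
Proof. by move=> a0; rewrite -powRrM mulfV ?gt_eqF// powRr1. Qed.

Lemma powR_leE a b : 0 <= a -> 0 <= b -> (a `^ p <= b `^ p) = (a <= b).
Proof.
move=> a0 b0; apply/idP/idP; last exact: ler_powR2r.
rewrite leNgt => h; rewrite leNgt; apply/negP => ba; move/negP: h; apply.
by apply: gt0_ltr_powR.
Qed.

(** With [s = a + b], the ratios [a / s] and [b / s] are at most [1], hence at
    most their powers of exponent [p <= 1]; and they add up to [1]. *)
Lemma powR_add_le a b : p <= 1 -> 0 <= a -> 0 <= b ->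
  (a + b) `^ p <= a `^ p + b `^ p.
Proof.
move=> p1 a0 b0; have [s0|s0] := eqVneq (a + b) 0.
  by rewrite s0 powR0 ?gt_eqF// addr_ge0 ?powR_ge0.
have {}s0 : 0 < a + b by rewrite lt_neqAle eq_sym s0 addr_ge0.
have frac x : 0 <= x -> x <= a + b -> x / (a + b) * (a + b) `^ p <= x `^ p.
  move=> x0 xs; have [->|xn0] := eqVneq x 0.
    by rewrite !mul0r powR_ge0.
  have xp : 0 < x by rewrite lt_neqAle eq_sym xn0.
  rewrite -[in leRHS](@divfK _ (a + b) _ x) ?gt_eqF// powRM ?divr_ge0 ?(ltW s0)//.
  rewrite ler_wpM2r ?powR_ge0// ger1_powR// divr_gt0//=.
  by rewrite ler_pdivrMr// mul1r.
have := lerD (frac a a0 _) (frac b b0 _); rewrite lerDl lerDr => /(_ b0 a0).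
by rewrite -mulrDl -mulrDl divff ?gt_eqF// mul1r.
Qed.

Lemma powR_sum_le (I : Type) (r : seq I) (f : I -> R) : p <= 1 ->
  (forall i, 0 <= f i) -> (\sum_(i <- r) f i) `^ p <= \sum_(i <- r) f i `^ p.
Proof.
move=> p1 f0; elim: r => [|i r IH]; first by rewrite !big_nil powR0 ?gt_eqF.
rewrite !big_cons (le_trans (powR_add_le p1 _ _))//; first exact: sumr_ge0.
by rewrite lerD2l.
Qed.

Lemma small_scale (C eps : R) : 0 <= C -> 0 < eps ->
  exists2 d : R, 0 < d & d <= eps /\ d `^ p * C <= eps.
Proof.
move=> C0 eps0; pose e := eps / (C + 1).
have e0 : 0 < e by rewrite divr_gt0// ltr_wpDl.
exists (Num.min eps (e `^ p^-1)); first by rewrite lt_min eps0 powR_gt0.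
split; first by rewrite ge_min lexx.
apply: (@le_trans _ _ (e * C)).
  rewrite ler_wpM2r// -[leRHS]powR_rootK ?(ltW e0)// ler_powR2r//.
    by rewrite le_min (ltW eps0) powR_ge0.
  by rewrite ge_min lexx orbT.
rewrite /e mulrAC ler_pdivrMr ?ltr_wpDl// ler_wpM2l ?ltW//.
by rewrite ltrDl.
Qed.

Lemma powR_norm_continuous : continuous (fun x : R => `|x| `^ p).
Proof.
move=> x; have [->|x0] := eqVneq x 0.
  apply/cvgrPdist_lt => eps eps0; rewrite normr0 powR0 ?gt_eqF//.
  have d0 : 0 < eps `^ p^-1 by exact: powR_gt0.
  apply/nbhs_ballP; exists (eps `^ p^-1) => //= y.
  rewrite /ball /= !sub0r !normrN => yd.
  rewrite ger0_norm ?powR_ge0// -[ltRHS]powR_rootK ?(ltW eps0)//.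
  by apply: gt0_ltr_powR; rewrite ?nnegrE ?powR_ge0.
have nc : {for x, continuous (Num.norm : R -> R)} by exact: norm_continuous.
suff pc : {for `|x|, continuous (fun y : R => y `^ p)}.
  exact: (continuous_comp nc pc).
apply: differentiable_continuous; apply/derivable1_diffP.
by apply: derivable_powR; rewrite in_itv/= andbT normr_gt0.
Qed.

End Powers.

Section NullSequences.
Variable R : realType.
Implicit Types e f : nat -> R.

(** For a nonnegative sequence, convergence to [0] ([null_seqP]). The one-sided
    form is stable under domination by another null sequence. *)
Definition null_seq e : Prop := forall eps : R, 0 < eps ->
  exists N, forall n, (N <= n)%N -> e n <= eps.

Lemma null_seq_le e f : (forall n, e n <= f n) -> null_seq f -> null_seq e.
Proof.
move=> ef f0 eps /f0[N NP]; exists N => n /NP; exact: le_trans.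
Qed.

Lemma null_seq0 : null_seq (fun=> 0).
Proof. by move=> eps /ltW; exists 0%N. Qed.

Lemma null_seqD e f : null_seq e -> null_seq f -> null_seq (fun n => e n + f n).
Proof.
move=> e0 f0 eps eps0; have eps2 : 0 < eps / 2 by rewrite divr_gt0.
have [N NP] := e0 _ eps2; have [M MP] := f0 _ eps2.
exists (maxn N M) => n; rewrite geq_max => /andP[Nn Mn].
by rewrite [eps]splitr lerD ?NP ?MP.
Qed.

Lemma null_seqZ (C : R) e : 0 <= C -> null_seq e -> null_seq (fun n => C * e n).
Proof.
move=> C0 e0 eps eps0.
have [N NP] := e0 (eps / (C + 1)) (divr_gt0 eps0 (ltr_wpDl C0 ltr01)).
exists N => n /NP en; apply: le_trans (ler_wpM2l C0 en) _.
exact: mul_divD1_le (ltW _).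
Qed.

Lemma null_seq_sum (I : Type) (r : seq I) (f : I -> nat -> R) :
  (forall i, null_seq (f i)) -> null_seq (fun n => \sum_(i <- r) f i n).
Proof.
move=> f0; elim: r => [|i r IH].
  by apply: null_seq_le null_seq0 => n; rewrite big_nil.
by apply: null_seq_le (null_seqD (f0 i) IH) => n; rewrite big_cons.
Qed.

Lemma null_seq_inv : null_seq (fun n => n.+1%:R^-1).
Proof.
move=> eps eps0; exists (Num.bound eps^-1) => n Nn.
rewrite -[leRHS]invrK lef_pV2 ?posrE ?invr_gt0// (le_trans (ltW (archi_boundP _)))//.
  by rewrite invr_ge0 ltW.
by rewrite ler_nat leqW.
Qed.

Lemma null_seq_powR (p : R) e : 0 < p -> (forall n, 0 <= e n) -> null_seq e ->
  null_seq (fun n => e n `^ p).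
Proof.
move=> p0 e_ge0 e0 eps eps0; have [N NP] := e0 _ (powR_gt0 p^-1 eps0).
exists N => n /NP en; rewrite -[leRHS](powR_rootK p0) ?(ltW eps0)//.
exact: ler_powR2r.
Qed.

Lemma null_seq_const (c : R) e : (forall n, c <= e n) -> null_seq e -> c <= 0.
Proof.
move=> ce e0; rewrite leNgt; apply/negP => c0.
have [N NP] := e0 _ (divr_gt0 c0 (ltr0n _ 2)).
by have := le_trans (ce N) (NP _ (leqnn N)); lra.
Qed.

Lemma null_seqP e : (forall n, 0 <= e n) ->
  e n @[n --> \oo] --> (0 : R) <-> null_seq e.
Proof.
move=> e_ge0; split=> [/cvgrPdist_le e0 eps /e0|e0].
  by move=> [N _ NP]; exists N => n /NP /=; rewrite sub0r normrN ger0_norm.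
apply/cvgrPdist_le => eps /e0[N NP]; exists N => // n /NP /=.
by rewrite sub0r normrN ger0_norm.
Qed.

End NullSequences.

(** * Lattice p-seminorms *)

(** The [p]-th power of a lattice [p]-seminorm. Unlike the seminorm itself it is
    subadditive, so that limits and quotients can be treated as for ordinary
    seminorms. *)
Record pseminorm (R : realType) (p : R) (V : vectorLatticeType R) (s : V -> R) :
    Prop := Pseminorm {
  psn_ge0 : forall x, 0 <= s x ;
  psnD : forall x y, s (x + y) <= s x + s y ;
  psnZ : forall (a : R) x, s (a *: x) = `|a| `^ p * s x ;
  psn_abs_le : forall x y, vle (vabs x) (vabs y) -> s x <= s y
}.

(** Applying the inequality to [a^-1] gives the converse inequality. *)
Lemma pseminorm_scale_eq (R : realType) (p : R) (V : lmodType R) (s : V -> R) :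
  0 < p -> (forall x, 0 <= s x) -> (forall a x, s (a *: x) <= `|a| `^ p * s x) ->
  forall a x, s (a *: x) = `|a| `^ p * s x.
Proof.
move=> p_gt0 s0 sZ a x; have [->|a0] := eqVneq a 0.
  have p0 : `|0 : R| `^ p = 0 by rewrite normr0 powR0// gt_eqF.
  apply/eqP; rewrite p0 mul0r eq_le s0 andbT.
  by have := sZ 0 x; rewrite p0 mul0r.
apply/eqP; rewrite eq_le sZ/=.
have := sZ a^-1 (a *: x); rewrite scalerA mulVf// scale1r.
have ap : 0 < `|a| `^ p by rewrite powR_gt0// normr_gt0.
move=> /(ler_wpM2l (ltW ap)); rewrite mulrA -powRM// -normrM divff// normr1.
by rewrite powR1 mul1r.
Qed.

Section PseminormTheory.
Variables (R : realType) (p : R) (V : vectorLatticeType R) (s : V -> R).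
Hypotheses (p_gt0 : 0 < p) (sP : pseminorm p s).
Implicit Types x y : V.

Lemma psn0 : s 0 = 0.
Proof. by rewrite -(scale0r 0) (psnZ sP) normr0 powR0 ?mul0r// gt_eqF. Qed.

Lemma psnN x : s (- x) = s x.
Proof. by rewrite -scaleN1r (psnZ sP) normrN1 powR1 mul1r. Qed.

Lemma psnB x y : s (x - y) = s (y - x).
Proof. by rewrite -psnN opprB. Qed.

Lemma psn_vabs x : s (vabs x) = s x.
Proof.
by apply/eqP; rewrite eq_le !(psn_abs_le sP)// vabs_id; exact: vle_refl.
Qed.

Lemma psn_le x y : vle (vabs x) y -> s x <= s y.
Proof. by move=> xy; apply: (psn_abs_le sP); apply: vle_trans (vle_abs y). Qed.

Lemma psn_le_scale (a : R) x y : 0 <= a -> vle (vabs x) (a *: y) ->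
  s x <= a `^ p * s y.
Proof. by move=> a0 /psn_le; rewrite (psnZ sP) ger0_norm. Qed.

Lemma psn_triangle y x z : s (x - z) <= s (x - y) + s (y - z).
Proof. by have := psnD sP (x - y) (y - z); rewrite addrA subrK. Qed.

Lemma psn_dist x y : `|s x - s y| <= s (x - y).
Proof.
have h u v : s u - s v <= s (u - v).
  by rewrite lerBlDr; have := psnD sP (u - v) v; rewrite subrK.
by rewrite ler_norml h andbT lerNl opprB (psnB x); exact: h.
Qed.

Lemma psn_join x y x' y' :
  s (vjoin x y - vjoin x' y') <= s (x - x') + s (y - y').
Proof.
apply: le_trans (psn_le (vabs_join _ _ _ _)) _.
by apply: le_trans (psnD sP _ _) _; rewrite !psn_vabs.
Qed.

Lemma psn_lin (a : R) x y x' y' :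
  s (a *: x + y - (a *: x' + y')) <= `|a| `^ p * s (x - x') + s (y - y').
Proof. by rewrite opprD addrACA -scalerBr -(psnZ sP); exact: (psnD sP). Qed.

End PseminormTheory.

(** * Quasi-normed spaces *)

Section QuasiNormed.
Variables (R : realType) (E : quasiNormedType R).
Implicit Types x y : E.

Lemma qnorm0 : qnorm (0 : E) = 0.
Proof. by rewrite -(scale0r 0) qnormZ normr0 mul0r. Qed.

End QuasiNormed.

Section OperatorNorm.
Variables (R : realType) (E F : quasiNormedType R) (f : {linear E -> F}).
Hypothesis f_cont : qcontinuous f.

Lemma operator_bounded : exists2 K : R, 0 <= K & forall x, qnorm (f x) <= K * qnorm x.
Proof.
have [d d0 dP] := f_cont 0 ltr01.
exists (2 / d) => [|x]; first by rewrite divr_ge0// ltW.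
have [x0|x0] := eqVneq (qnorm x) 0.
  by rewrite (qnorm_eq0 _ x0) raddf0 !qnorm0 mulr0.
have {}x0 : 0 < qnorm x by rewrite lt_neqAle eq_sym x0 qnorm_ge0.
pose a := d / (2 * qnorm x).
have a0 : 0 < a by rewrite divr_gt0// mulr_gt0.
have : qnorm (f (a *: x) - f 0) < 1.
  apply: dP; rewrite subr0 qnormZ gtr0_norm// /a invfM mulrA divfK ?gt_eqF//.
  by rewrite ltr_pdivrMr// ltr_pMr// ltr1n.
rewrite raddf0 subr0 linearZ_LR qnormZ gtr0_norm// => /ltW.
rewrite -ler_pdivlMl// => /le_trans; apply.
by rewrite mulr1 /a invf_div mulrAC.
Qed.

Lemma opnorm_has_sup : has_sup [set qnorm (f x) | x in [set x : E | qnorm x <= 1]].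
Proof.
split; first by exists (qnorm (f 0)), 0 => //=; rewrite qnorm0.
have [K K0 KP] := operator_bounded; exists K => _ [x /= x1 <-].
by apply: le_trans (KP x) _; rewrite -[leRHS]mulr1 ler_wpM2l.
Qed.

Lemma opnorm_ge0 : 0 <= opnorm f.
Proof.
apply: le_trans (qnorm_ge0 (f 0)) _; apply: ub_le_sup.
  by have [] := opnorm_has_sup.
by exists 0 => //=; rewrite qnorm0.
Qed.

Lemma qnorm_le_opnorm x : qnorm (f x) <= opnorm f * qnorm x.
Proof.
have [x0|x0] := eqVneq (qnorm x) 0.
  by rewrite (qnorm_eq0 _ x0) raddf0 !qnorm0 mulr0.
have {}x0 : 0 < qnorm x by rewrite lt_neqAle eq_sym x0 qnorm_ge0.
rewrite -ler_pdivrMr//.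
have -> : qnorm (f x) / qnorm x = qnorm (f ((qnorm x)^-1 *: x)).
  by rewrite linearZ_LR qnormZ gtr0_norm ?invr_gt0// mulrC.
apply: ub_le_sup; first by have [] := opnorm_has_sup.
by exists ((qnorm x)^-1 *: x) => //=; rewrite qnormZ gtr0_norm ?invr_gt0// mulVf ?gt_eqF.
Qed.

End OperatorNorm.

Lemma bounded_qcontinuous (R : realType) (E F : quasiNormedType R)
    (f : {linear E -> F}) (K : R) :
  (forall x, qnorm (f x) <= K * qnorm x) -> qcontinuous f.
Proof.
move=> fK x eps eps0; pose K' := `|K| + 1.
have K'0 : 0 < K' by rewrite ltr_wpDl.
exists (eps / K') => [|y yd]; first by rewrite divr_gt0.
rewrite -raddfB (le_lt_trans (fK _))//.
apply: (@le_lt_trans _ _ (K' * qnorm (y - x))).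
  by rewrite ler_wpM2r ?qnorm_ge0// (le_trans (ler_norm _))// lerDl.
by rewrite mulrC -ltr_pdivlMr.
Qed.

Lemma opnorm_le (R : realType) (E F : quasiNormedType R) (f : E -> F) (K : R) :
  0 <= K -> (forall x, qnorm (f x) <= K * qnorm x) -> opnorm f <= K.
Proof.
move=> K0 fK; apply: ge_sup.
  by exists (qnorm (f 0)), 0 => //=; rewrite qnorm0.
by move=> _ [x /= x1 <-]; apply: le_trans (fK x) _; rewrite -[leRHS]mulr1 ler_wpM2l.
Qed.

(** * p-Banach lattices *)

Section PBanachLattice.
Variables (R : realType) (p : R) (X : quasiBanachLatticeType R).
Hypotheses (p_gt0 : 0 < p) (X_pnormed : pnormed p X).
Implicit Types x y : X.

Definition pnorm x : R := qnorm x `^ p.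

Lemma pnorm_pseminorm : pseminorm p pnorm.
Proof.
split=> [x|x y|a x|x y xy]; first exact: powR_ge0.
- exact: X_pnormed.
- by rewrite /pnorm qnormZ powRM ?qnorm_ge0.
- by apply: ler_powR2r => //; [exact: qnorm_ge0|exact: qnorm_vabs].
Qed.

Lemma pnorm_eq0 x : pnorm x <= 0 -> x = 0.
Proof.
move=> x0; apply/qnorm_eq0/(@powR_eq0_eq0 _ _ p)/eqP.
by rewrite -/(pnorm x) eq_le x0 powR_ge0.
Qed.

Lemma pnorm_rootK x : pnorm x `^ p^-1 = qnorm x.
Proof. by rewrite powR_powK// qnorm_ge0. Qed.

Lemma pnorm_complete (u : nat -> X) :
  (forall eps, 0 < eps -> exists N, forall m n, (N <= m)%N -> (N <= n)%N ->
     pnorm (u m - u n) <= eps) ->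
  exists l, null_seq (fun n => pnorm (u n - l)).
Proof.
move=> uC; have [eps eps0|l lP] := qcomplete u.
  have e2 : 0 < (eps / 2) `^ p by rewrite powR_gt0// divr_gt0.
  have [N NP] := uC _ e2; exists N => m n Nm Nn.
  have := NP m n Nm Nn; rewrite /pnorm powR_leE ?qnorm_ge0 ?divr_ge0 ?(ltW eps0)//.
  by move=> /le_lt_trans; apply; rewrite ltr_pdivrMr// ltr_pMr// ltr1n.
exists l; apply: null_seq_powR => // [n|]; first exact: qnorm_ge0.
by apply/null_seqP => // n; exact: qnorm_ge0.
Qed.

Lemma pnorm_limit_unique (u : nat -> X) x y : null_seq (fun n => pnorm (u n - x)) ->
  null_seq (fun n => pnorm (u n - y)) -> x = y.
Proof.
move=> ux uy; apply/eqP; rewrite -subr_eq0; apply/eqP/pnorm_eq0.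
apply: null_seq_const (null_seqD ux uy) => n.
rewrite (psnB pnorm_pseminorm (u n) x).
exact: psn_triangle pnorm_pseminorm _ _ _.
Qed.

End PBanachLattice.

(** * Krivine functional calculus *)

Section NearEval.
Variables (R : realType) (p : R) (X : quasiBanachLatticeType R).
Hypotheses (p_gt0 : 0 < p) (X_pnormed : pnormed p X).
Variables (n : nat) (x : 'I_n -> X).
Implicit Types (g h : 'rV[R]_n -> R) (y z : X) (w : word 'rV[R]_n).

Let qn := @pnorm R p X.
Let qnP : pseminorm p qn := pnorm_pseminorm p_gt0 X_pnormed.
Let ev w := word_eval (lincomb x) w.

(** The relation [h(x) = y], independently of any functional calculus: words
    that approximate [h] uniformly on the l1-sphere have values at [x] that
    approximate [y]. *)
Definition calculus_value h y : Prop := forall eps : R, 0 < eps ->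
  exists w, (forall t, `|h t - word_fun w t| <= eps * l1norm t) /\
    qn (y - ev w) <= eps.

Let C := qn (\sum_k vabs (x k)).

Let C_ge0 : 0 <= C. Proof. exact: psn_ge0 qnP _. Qed.

Lemma word_eval_dist (w w' : word 'rV[R]_n) (eps : R) : 0 <= eps ->
  (forall t, `|word_fun w t - word_fun w' t| <= eps * l1norm t) ->
  qn (ev w - ev w') <= eps `^ p * C.
Proof.
by move=> eps0 ww'; apply: (psn_le_scale qnP) => //; exact: word_fun_transfer.
Qed.

Lemma calculus_value_unique h y z :
  calculus_value h y -> calculus_value h z -> y = z.
Proof.
move=> hy hz; apply/eqP; rewrite -subr_eq0; apply/eqP/(@pnorm_eq0 _ p).
apply/ler_addgt0Pr => eps eps0; rewrite add0r.
have [d d0 [de dC]] := small_scale p_gt0 C_ge0 (divr_gt0 eps0 (ltr0n _ 3)).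
have d2 : 0 < d / 2 by rewrite divr_gt0.
have [w [hw yw]] := hy _ d2; have [w' [hw' zw']] := hz _ d2.
apply: le_trans (psn_triangle qnP (ev w) _ _) _.
have := psn_triangle qnP (ev w') (ev w) z; have := psnB qnP (ev w') z.
have : qn (ev w - ev w') <= d `^ p * C.
  apply: word_eval_dist (ltW d0) _ => t.
  have -> : d * l1norm t = d / 2 * l1norm t + d / 2 * l1norm t by field.
  apply: le_trans (ler_distD (h t) _ _) _.
  by rewrite lerD// distrC.
by lra.
Qed.

Lemma calculus_value_coord k : calculus_value (fun t => t ord0 k) (x k).
Proof.
move=> eps eps0; exists (word_var (delta_mx ord0 k)); split=> [t|].
  rewrite /word_fun word_eval_var /= lincomb_delta subrr normr0.
  by rewrite mulr_ge0 ?l1norm_ge0// ltW.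
by rewrite /ev word_eval_var /= lincomb_delta subrr (psn0 p_gt0 qnP) ltW.
Qed.

Lemma calculus_value_lin (a : R) g h y z : calculus_value g y ->
  calculus_value h z -> calculus_value (fun t => a * g t + h t) (a *: y + z).
Proof.
move=> gy hz eps eps0; pose D := 1 + `|a| + `|a| `^ p.
have D0 : 0 < D by rewrite ltr_wpDr ?powR_ge0// ltr_wpDr.
have d0 : 0 < eps / D by rewrite divr_gt0.
have dD : `|a| * (eps / D) + (eps / D) + `|a| `^ p * (eps / D) = eps.
  by rewrite /D; field; rewrite gt_eqF.
have [w [gw yw]] := gy _ d0; have [w' [hw' zw']] := hz _ d0.
exists (word_add (word_scale a w) w'); split=> [t|].
  rewrite /word_fun word_eval_add word_eval_scale.
  rewrite [X in `|_ - X|]/(a * word_fun w t + word_fun w' t).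
  rewrite opprD addrACA -mulrBr (le_trans (ler_normD _ _))// normrM.
  have := l1norm_ge0 t => t0.
  apply: le_trans (lerD (ler_wpM2l (normr_ge0 a) (gw t)) (hw' t)) _.
  rewrite mulrA -mulrDl ler_wpM2r// -[leRHS]dD lerDl.
  by rewrite mulr_ge0 ?powR_ge0// ltW.
rewrite /ev word_eval_add word_eval_scale (le_trans (psn_lin qnP _ _ _ _ _))//.
apply: le_trans (lerD (ler_wpM2l (powR_ge0 _ _) yw) zw') _.
by rewrite -[leRHS]dD addrC -addrA lerDr mulr_ge0// ltW.
Qed.

Lemma calculus_value_max g h y z : calculus_value g y ->
  calculus_value h z -> calculus_value (fun t => Num.max (g t) (h t)) (vjoin y z).
Proof.
move=> gy hz eps eps0; have d0 : 0 < eps / 2 by rewrite divr_gt0.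
have [w [gw yw]] := gy _ d0; have [w' [hw' zw']] := hz _ d0.
exists (word_join w w'); split=> [t|].
  rewrite /word_fun word_eval_join.
  have := @vabs_join _ R^o (g t) (h t) (word_fun w t) (word_fun w' t).
  rewrite vle_realE !vabs_realE => /le_trans; apply.
  by rewrite [eps]splitr mulrDl lerD.
rewrite /ev word_eval_join (le_trans (psn_join qnP _ _ _ _))//.
by rewrite [eps]splitr lerD.
Qed.

Lemma calculus_value0 : calculus_value (fun=> 0) 0.
Proof.
move=> eps eps0; exists ([::], [::]).
have ev0 (Y : vectorLatticeType R) (T : 'rV[R]_n -> Y) : word_eval T ([::], [::]) = 0.
  by rewrite /word_eval /= subrr.
split=> [t|]; last by rewrite /ev ev0 subrr (psn0 p_gt0 qnP) ltW.
by rewrite /word_fun ev0 subrr normr0 mulr_ge0 ?l1norm_ge0// ltW.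
Qed.

Lemma calculus_value_min g h y z : calculus_value g y ->
  calculus_value h z -> calculus_value (fun t => Num.min (g t) (h t)) (vmeet y z).
Proof.
move=> gy hz.
have opp k v : calculus_value k v -> calculus_value (fun t => - k t) (- v).
  move=> kv; have := calculus_value_lin (-1) kv calculus_value0.
  rewrite scaleN1r addr0; congr calculus_value.
  by apply/funext => t; rewrite mulN1r addr0.
have := opp _ _ (calculus_value_max (opp _ _ gy) (opp _ _ hz)).
rewrite -vmeetE; congr calculus_value.
by apply/funext => t; rewrite oppr_max !opprK.
Qed.

(** Values at [x] of words converging to [h] form a Cauchy sequence, by
    [word_eval_dist]. *)
Lemma calculus_value_exists h : Hcone h -> exists y, calculus_value h y.
Proof.
move=> hH.
have /choice[w wP] (m : nat) :
    exists w, forall t, `|h t - word_fun w t| <= m.+1%:R^-1 * l1norm t.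
  by apply: word_approx; rewrite ?invr_gt0.
have [|y yP] := pnorm_complete p_gt0 (u := fun m => ev (w m)).
  move=> eps eps0; have [d d0 [_ dC]] := small_scale p_gt0 C_ge0 eps0.
  have [N NP] := @null_seq_inv R _ (divr_gt0 d0 (ltr0n _ 2)).
  exists N => m k /NP md /NP kd; apply: le_trans dC.
  apply: word_eval_dist (ltW d0) _ => t; apply: le_trans (ler_distD (h t) _ _) _.
  rewrite [X in _ <= X * _]splitr mulrDl distrC lerD//.
    by apply: le_trans (wP _ _) _; rewrite ler_wpM2r ?l1norm_ge0.
  by apply: le_trans (wP _ _) _; rewrite ler_wpM2r ?l1norm_ge0.
exists y => eps eps0; have [N NP] := yP _ eps0.
have [M MP] := @null_seq_inv R _ eps0.
exists (w (maxn N M)); split=> [t|].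
  by apply: le_trans (wP _ _) _; rewrite ler_wpM2r ?l1norm_ge0 ?MP// leq_maxr.
by rewrite (psnB qnP) NP// leq_maxl.
Qed.

(** A functional calculus agrees with [word_eval] on words and is monotone, so
    an estimate of [h] by a word within [d * l1norm] yields the same estimate
    of its value. *)
Section Uniqueness.
Variable tau : ('rV[R]_n -> R) -> X.
Hypothesis tauP : functional_calculus x tau.

Let tau_lin (a : R) g h : Hcone g -> Hcone h ->
  tau (fun t => a * g t + h t) = a *: tau g + tau h.
Proof. by case: tauP => _ + _ _; exact. Qed.

Let tau_max g h : Hcone g -> Hcone h ->
  tau (fun t => Num.max (g t) (h t)) = vjoin (tau g) (tau h).
Proof. by case: tauP => _ _ + _; exact. Qed.

Let tau0 : tau (fun=> 0) = 0.
Proof.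
have := tau_lin (-1) (@Hcone0 R n) (@Hcone0 R n).
rewrite scaleN1r addNr => <-; congr tau.
by apply/funext => t; rewrite mulr0 addr0.
Qed.

Let tau_lincomb c : tau (fun t => lincomb (fun k => t ord0 k : R^o) c) = lincomb x c.
Proof.
have [tau_coord _ _ _] := tauP; rewrite /lincomb.
elim: (index_enum _) => [|k r IH].
  by rewrite big_nil -[RHS]tau0; congr tau; apply/funext => t; rewrite big_nil.
have rH : Hcone (fun t => \sum_(j <- r) c ord0 j *: (t ord0 j : R^o)).
  by apply: Hcone_sum => j; exact: Hcone_scale (Hcone_coord R j).
rewrite big_cons -IH -tau_coord -(tau_lin (c ord0 k) (Hcone_coord R k) rH).
by congr tau; apply/funext => t; rewrite big_cons.
Qed.

Let tau_vmax0 (s : seq 'rV[R]_n) :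
  tau (fun t => vmax0 (map (lincomb (fun k => t ord0 k : R^o)) s)) =
  vmax0 (map (lincomb x) s).
Proof.
elim: s => [|c s IH] /=; first exact: tau0.
rewrite -IH -tau_lincomb -tau_max//; first exact: Hcone_lincomb.
exact: Hcone_vmax0.
Qed.

Let tau_word w : tau (word_fun w) = ev w.
Proof.
rewrite /ev /word_eval -!tau_vmax0 addrC -scaleN1r -tau_lin; last 2 first.
- exact: Hcone_vmax0.
- exact: Hcone_vmax0.
by congr tau; apply/funext => t; rewrite mulN1r addrC.
Qed.

Let tau_mono g h : Hcone g -> Hcone h -> (forall t, g t <= h t) ->
  vle (tau g) (tau h).
Proof.
move=> gH hH gh; rewrite vjoin_idPl -tau_max//; congr tau.
by apply/funext => t; apply/max_idPr.
Qed.

Lemma functional_calculus_value h : Hcone h -> calculus_value h (tau h).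
Proof.
move=> hH eps eps0; have [d d0 [de dC]] := small_scale p_gt0 C_ge0 eps0.
have [w wP] := word_approx hH d0; exists w; split=> [t|].
  by apply: le_trans (wP t) _; rewrite ler_wpM2r ?l1norm_ge0.
apply: le_trans dC; apply: (psn_le_scale qnP) (ltW d0) _.
have [w1 w1E] := @is_word_fun_l1norm R n.
have l1H : Hcone (@l1norm R n) by exact/is_word_fun_Hcone/is_word_fun_l1norm.
have l1x : vle (ev w1) (\sum_k vabs (x k)).
  rewrite -[X in vle _ X]scale1r.
  have := @word_fun_transfer _ _ _ x w1 ([::], [::]) 1 ler01.
  rewrite {2}/word_eval /= subrr subr0 => h1; apply: vle_trans (vle_abs _) (h1 _).
  move=> t; rewrite w1E /word_fun /word_eval /= !subr0.
  by rewrite mul1r ger0_norm// l1norm_ge0.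
have hw t : h t <= d * l1norm t + word_fun w t.
  by have := wP t; rewrite ler_norml => /andP[_]; rewrite lerBlDr.
have wh t : word_fun w t <= d * l1norm t + h t.
  by have := wP t; rewrite distrC ler_norml => /andP[_]; rewrite lerBlDr.
have bound g k : Hcone g -> Hcone k -> (forall t, g t <= d * l1norm t + k t) ->
    vle (tau g - tau k) (d *: \sum_k vabs (x k)).
  move=> gH kH /(tau_mono gH (Hcone_lin d l1H kH)); rewrite tau_lin// -vle_subLR.
  by move=> /vle_trans; apply; rewrite -w1E tau_word; exact: vle_scale (ltW d0) l1x.
rewrite -/(ev w) -tau_word; apply/vabs_le; rewrite opprB; split; apply: bound => //;
  exact: Hcone_word.
Qed.

End Uniqueness.

(** Krivine's theorem: the values [calculus_value] constitute a functional
    calculus, and [functional_calculus_value] identifies every other functional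
    calculus with it. *)
Lemma krivine_value h : Hcone h -> calculus_value h (krivine x h).
Proof.
move=> hH; rewrite /krivine; case: xgetP => [y _ [tau tauP <-]|/(_ (xget 0 (calculus_value h)))].
  exact: functional_calculus_value.
pose tau g := xget 0 (calculus_value g).
have tauE g y : calculus_value g y -> tau g = y.
  by move=> gy; apply: xget_unique (gy) _ => z gz; exact: calculus_value_unique gz gy.
have tauV g : Hcone g -> calculus_value g (tau g).
  by move=> /calculus_value_exists[y gy]; rewrite (tauE _ _ gy).
case; exists tau => //; split=> [k|a g k /tauV gH /tauV kH|g k /tauV gH /tauV kH|
  g k /tauV gH /tauV kH];
  apply: tauE.
- exact: calculus_value_coord.
- exact: calculus_value_lin.
- exact: calculus_value_max.
- exact: calculus_value_min.
Qed.

End NearEval.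

(** * p-convexity *)

Section LpFun.
Variables (R : realType) (p : R).
Hypothesis p_gt0 : 0 < p.

Lemma lp_fun_powR n (t : 'rV[R]_n) : lp_fun p t `^ p = \sum_k `|t ord0 k| `^ p.
Proof.
by rewrite /lp_fun powR_rootK// sumr_ge0// => k _; rewrite powR_ge0.
Qed.

Lemma Hcone_lp n : Hcone (@lp_fun R p n).
Proof.
have pV0 : 0 < p^-1 by rewrite invr_gt0.
split=> [t|a t a0]; last first.
  rewrite /lp_fun -[in RHS](powR_powK p_gt0 a0) -powRM ?powR_ge0//; last first.
    by rewrite sumr_ge0// => k _; rewrite powR_ge0.
  congr (_ `^ _); rewrite mulr_sumr; apply: eq_bigr => k _.
  by rewrite mxE normrM ger0_norm// powRM.
pose S (u : 'rV[R]_n) : R := \sum_(k < n) `|u ord0 k| `^ p.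
have -> : @lp_fun R p n = (fun x : R => `|x| `^ p^-1) \o S.
  apply/funext => u /=; rewrite ger0_norm//.
  by rewrite sumr_ge0// => k _; rewrite powR_ge0.
apply: continuous_comp; last exact: powR_norm_continuous.
rewrite /S; elim: (index_enum _) => [|k r IH].
  have -> : (fun u : 'rV[R]_n => \sum_(k <- [::]) `|u ord0 k| `^ p) = fun=> 0.
    by apply/funext => u; rewrite big_nil.
  exact: cst_continuous.
have -> : (fun u : 'rV[R]_n => \sum_(j <- k :: r) `|u ord0 j| `^ p) =
    fun u => 1 * `|u ord0 k| `^ p + \sum_(j <- r) `|u ord0 j| `^ p.
  by apply/funext => u; rewrite big_cons mul1r.
apply: (@continuous_lin R 'rV[R]_n _ (fun u => `|u ord0 k| `^ p)) IH.
apply: (@continuous_comp 'rV[R]_n R R (fun u => u ord0 k) (fun x => `|x| `^ p)).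
  exact: coord_continuous.
exact: powR_norm_continuous.
Qed.

End LpFun.

Section Convexity.
Variables (R : realType) (p : R) (X : quasiBanachLatticeType R).
Hypotheses (p_gt0 : 0 < p) (X_pnormed : pnormed p X).

Local Notation qn := (@pnorm R p X).

Lemma pconvex_with_pnorm (C : R) n (x : 'I_n -> X) : 0 <= C -> pconvex_with p X C ->
  qn (krivine x (@lp_fun R p n)) <= C `^ p * \sum_k qn (x k).
Proof.
move=> C0 /(_ n x) h.
have S0 : 0 <= \sum_k qn (x k) by rewrite sumr_ge0// => k _; exact: powR_ge0.
rewrite -[X in _ * X](powR_rootK p_gt0 S0) -powRM ?powR_ge0//.
exact: ler_powR2r (qnorm_ge0 _) h.
Qed.

(** The hypothesis says that [`|w|] lies below the [p]-sum of the family [s] at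
    every functional. Replacing the [p]-sum by a word [v] up to [d] times the
    l1-norm, the inequality transfers to [X], where the value of [v] is close
    to the element to which [p]-convexity applies. *)
Lemma pconvex_word_bound (C : R) (E : lmodType R) (T : {linear E -> X})
    (w : word E) (s : seq E) : 0 <= C -> pconvex_with p X C ->
  (forall phi : {linear E -> R^o},
     `|word_eval phi w| `^ p <= \sum_(e <- s) `|phi e| `^ p) ->
  qn (word_eval T w) <= C `^ p * \sum_(e <- s) qn (T e).
Proof.
move=> C0 XC ws; have qnP := pnorm_pseminorm p_gt0 X_pnormed.
pose e (k : 'I_(size s)) := nth 0 s k; pose x k := T (e k).
pose y := krivine x (@lp_fun R p _).
have big_s (M : nmodType) (f : E -> M) : \sum_(e <- s) f e = \sum_k f (e k).
  by rewrite (big_nth 0) big_mkord.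
have yC : qn y <= C `^ p * \sum_(e <- s) qn (T e).
  by rewrite big_s; exact: pconvex_with_pnorm.
have yV : calculus_value p x (@lp_fun R p _) y.
  exact: krivine_value (Hcone_lp p_gt0 _).
pose A := \sum_(e <- s) vabs (T e).
apply/ler_addgt0Pr => eps eps0.
have [d d0 [dle dA]] := small_scale p_gt0 (psn_ge0 qnP A) (divr_gt0 eps0 (ltr0n _ 2)).
have [v [hv yv]] := yV _ d0.
pose vE := word_add (word_map (lincomb e) v) (word_scale d (word_l1 s)).
have vEE : word_eval T vE = word_eval (lincomb x) v + d *: A.
  rewrite word_eval_add word_eval_scale word_eval_l1 word_eval_map; congr (_ + _).
  apply: eq_word_eval => c /=; rewrite /lincomb linear_sum.
  by apply: eq_bigr => k _; rewrite linearZ_LR.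
have : vle (vabs (word_eval T w)) (word_eval T vE).
  apply: word_transfer_abs => phi; pose t : 'rV[R]_(size s) := \row_k phi (e k).
  have -> : word_eval phi vE = word_fun v t + d * l1norm t.
    rewrite word_eval_add word_eval_scale word_eval_l1 word_eval_map.
    congr (_ + _ *: _); last first.
      by rewrite big_s; apply: eq_bigr => k _; rewrite mxE vabs_realE.
    apply: eq_word_eval => c /=; rewrite /lincomb linear_sum.
    by apply: eq_bigr => k _; rewrite linearZ_LR mxE.
  have wt : `|word_eval phi w| <= lp_fun p t.
    rewrite -(powR_leE p_gt0) ?powR_ge0// lp_fun_powR// (le_trans (ws phi))//.
    by rewrite big_s; apply: ler_sum => k _; rewrite mxE.
  apply: le_trans wt _; have := hv t; rewrite ler_norml => /andP[_].
  by rewrite lerBlDl.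
move=> /(psn_le qnP)/le_trans; apply; rewrite vEE.
apply: le_trans (psnD qnP _ _) _; rewrite (psnZ qnP) gtr0_norm//.
have := psn_triangle qnP y (word_eval (lincomb x) v) 0; rewrite !subr0.
rewrite (psnB qnP _ y).
move: (le_trans yv dle) yC dA => /= ? ? ? ?.
lra.
Qed.

(** The admissible constants form a closed half-line, so the infimum is
    attained. *)
Lemma pconvexity_constantP : pconvex p X ->
  1 <= pconvexity_constant p X /\ pconvex_with p X (pconvexity_constant p X).
Proof.
move=> [C C0 XC]; pose S := [set C : R | 1 <= C /\ pconvex_with p X C].
have mono (a b : R) : a <= b -> pconvex_with p X a -> pconvex_with p X b.
  move=> ab Xa n x; apply: le_trans (Xa n x) _.
  by rewrite ler_wpM2r// powR_ge0.
have S0 : S !=set0.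
  exists (Num.max 1 C); split; first by rewrite le_max lexx.
  by apply: mono XC; rewrite le_max lexx orbT.
have lbS : lbound S 1 by move=> a [].
have hS : has_inf S by split=> //; exists 1.
split=> [|n x]; first exact: lb_le_inf.
apply/ler_addgt0Pr => eps eps0.
pose B := (\sum_(k < n) qnorm (x k) `^ p) `^ p^-1.
have B0 : 0 <= B by exact: powR_ge0.
have d0 : 0 < eps / (B + 1) by rewrite divr_gt0// ltr_wpDl.
have [c [_ Xc] cd] := inf_adherent d0 hS.
apply: le_trans (Xc n x) _; apply: le_trans (ler_wpM2r B0 (ltW cd)) _.
rewrite mulrDl lerD2l mulrAC ler_pdivrMr ?ltr_wpDl// ler_wpM2l ?(ltW eps0)//.
by rewrite lerDl.
Qed.

End Convexity.

(** * Completion of a p-seminormed vector lattice *)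

Lemma real_cauchy_limit (R : realType) (a : nat -> R) :
  (forall eps, 0 < eps -> exists N, forall m n, (N <= m)%N -> (N <= n)%N ->
     `|a m - a n| <= eps) ->
  exists r, null_seq (fun n => `|a n - r|).
Proof.
move=> aC; pose S := [set x | exists N, forall n, (N <= n)%N -> x <= a n].
have near_sup eps : 0 < eps -> exists N, forall n, (N <= n)%N ->
    S (a n - eps) /\ ubound S (a n + eps).
  move=> eps0; have [N NP] := aC _ eps0; exists N => n Nn; split.
    exists N => k Nk; have := NP n k Nn Nk.
    by rewrite ler_norml => /andP[_]; rewrite lerBlDr lerBlDr addrC.
  move=> x [M MP]; pose k := maxn N M.
  have := NP k n (leq_maxl _ _) Nn; have := MP k (leq_maxr _ _).
  by rewrite ler_norml => xk /andP[_ kn]; lra.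
have hS : has_sup S.
  have [N NP] := near_sup _ ltr01; have [SN uN] := NP N (leqnn N).
  by split; [exists (a N - 1)|exists (a N + 1)].
(* [sup S] is the lower limit of [a]. *)
exists (sup S) => eps eps0; have [N NP] := near_sup _ eps0; exists N => n Nn.
have [Sn un] := NP n Nn.
have h1 : sup S <= a n + eps by apply: ge_sup => //; case: hS.
have h2 : a n - eps <= sup S by apply: ub_le_sup => //; case: hS.
by rewrite ler_norml; apply/andP; split; lra.
Qed.

(** Bundled, so that a single term determines the structures on the
    completion. *)
Record seminormedLattice (R : realType) (p : R) := SeminormedLattice {
  sl_sort :> vectorLatticeType R ;
  snorm : sl_sort -> R ;
  snormP : pseminorm p snorm ;
  sl_exponent_gt0 : 0 < p
}.

Section CauchySequences.
Variables (R : realType) (p : R) (W : seminormedLattice p).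

Let p_gt0 := sl_exponent_gt0 W.
Let sP := snormP W.

Definition is_cauchy (u : nat -> W) : Prop := forall eps : R, 0 < eps ->
  exists N, forall m n, (N <= m)%N -> (N <= n)%N -> snorm (u m - u n) <= eps.

Definition cauchy_pred : {pred nat -> W} := mem [set u | is_cauchy u].

Lemma cauchy_submod_closed : submod_closed cauchy_pred.
Proof.
split=> [|a u v]; rewrite !inE.
  move=> eps /ltW eps0; exists 0%N => m n _ _.
  by rewrite subrr (psn0 p_gt0 sP).
move=> uC vC eps eps0; have eps2 : 0 < eps / 2 by rewrite divr_gt0.
have a0 : 0 < `|a| `^ p + 1 by rewrite ltr_wpDl ?powR_ge0.
have [N NP] := uC _ (divr_gt0 eps2 a0); have [M MP] := vC _ eps2.
exists (maxn N M) => m n; rewrite !geq_max => /andP[Nm Mm] /andP[Nn Mn].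
apply: le_trans (psn_lin sP _ _ _ _ _) _; rewrite [eps]splitr lerD ?MP//.
apply: le_trans (ler_wpM2l (powR_ge0 _ _) (NP _ _ Nm Nn)) _.
by rewrite mul_divD1_le ?powR_ge0// ltW.
Qed.

HB.instance Definition _ :=
  GRing.isSubmodClosed.Build R (nat -> W) cauchy_pred cauchy_submod_closed.

Record cseq := Cseq { cseq_val :> nat -> W ; cseq_in : cseq_val \in cauchy_pred }.

HB.instance Definition _ := [isSub of cseq for cseq_val].
HB.instance Definition _ := [Choice of cseq by <:].
HB.instance Definition _ := [SubChoice_isSubLmodule of cseq by <:].

Lemma cseqP (u : cseq) : is_cauchy u.
Proof. by have := cseq_in u; rewrite inE. Qed.

Lemma cseq_join_in (u v : cseq) : (vjoin (u : nat -> W) v) \in cauchy_pred.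
Proof.
rewrite inE => eps eps0; have eps2 : 0 < eps / 2 by rewrite divr_gt0.
have [N NP] := cseqP u eps2; have [M MP] := cseqP v eps2.
exists (maxn N M) => m n; rewrite !geq_max => /andP[Nm Mm] /andP[Nn Mn].
by rewrite (le_trans (psn_join sP _ _ _ _))// [eps]splitr lerD ?MP ?NP.
Qed.

Definition cseq_join (u v : cseq) := Cseq (cseq_join_in u v).

Fact cseq_joinC : commutative cseq_join.
Proof. by move=> u v; apply: val_inj; exact: vjoinC. Qed.

Fact cseq_joinA : associative cseq_join.
Proof. by move=> u v w; apply: val_inj; exact: vjoinA. Qed.

Fact cseq_joinxx : idempotent_op cseq_join.
Proof. by move=> u; apply: val_inj; exact: vjoinxx. Qed.

Fact cseq_joinDr (u v w : cseq) :
  cseq_join (u + w) (v + w) = cseq_join u v + w.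
Proof. by apply: val_inj; exact: vjoinDr. Qed.

Fact cseq_joinZ (a : R) (u v : cseq) :
  0 <= a -> cseq_join (a *: u) (a *: v) = a *: cseq_join u v.
Proof. by move=> a0; apply: val_inj; exact: vjoin_scale. Qed.

HB.instance Definition _ := Lmodule_hasJoin.Build R cseq
  cseq_joinC cseq_joinA cseq_joinxx cseq_joinDr cseq_joinZ.

Definition null_pred : {pred cseq} := mem [set u | null_seq (fun n => snorm (cseq_val u n))].

Lemma null_zmod_closed : zmod_closed null_pred.
Proof.
split=> [|u v]; rewrite !inE /=.
  by apply: null_seq_le (@null_seq0 R) => n; rewrite (psn0 p_gt0 sP).
move=> u0 v0; apply: null_seq_le (null_seqD u0 v0) => n /=.
by rewrite (le_trans (psnD sP _ _))// (psnN sP).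
Qed.

HB.instance Definition _ := GRing.isZmodClosed.Build cseq null_pred null_zmod_closed.

Definition completion : Type := @Quotient.quot cseq null_pred.

HB.instance Definition _ := GRing.Zmodule.on completion.

Definition limit_of (u : cseq) : completion := (\pi_(@Quotient.quot cseq null_pred) u)%qT.

Lemma limit_of_surj (x : completion) : exists u, limit_of u = x.
Proof. by exists (repr x); rewrite /limit_of reprK. Qed.

Lemma limit_of_eq (u v : cseq) :
  limit_of u = limit_of v <-> null_seq (fun n => snorm (u n - v n)).
Proof.
rewrite /limit_of; split=> [/eqP|h]; first by rewrite -Quotient.idealrBE inE.
by apply/eqP; rewrite -Quotient.idealrBE inE.
Qed.

Lemma limit_of_is_zmod : zmod_morphism limit_of.
Proof. by move=> u v; rewrite /limit_of !piE. Qed.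

HB.instance Definition _ :=
  GRing.isZmodMorphism.Build cseq completion limit_of limit_of_is_zmod.

Definition rep (x : completion) : cseq := sval (cid (limit_of_surj x)).

Lemma repK x : limit_of (rep x) = x.
Proof. by rewrite /rep; case: cid. Qed.

Lemma rep_limit (u : cseq) : null_seq (fun n => snorm (rep (limit_of u) n - u n)).
Proof. by apply/limit_of_eq; rewrite repK. Qed.

Definition cscale (a : R) (x : completion) : completion := limit_of (a *: rep x).

Lemma cscale_limit (a : R) (u : cseq) : cscale a (limit_of u) = limit_of (a *: u).
Proof.
apply/limit_of_eq; have := null_seqZ (powR_ge0 `|a| p) (rep_limit u).
by apply: null_seq_le => n; rewrite -(psnZ sP) scalerBr.
Qed.

Fact cscaleA (a b : R) x : cscale a (cscale b x) = cscale (a * b) x.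
Proof. by rewrite -[x]repK !cscale_limit scalerA. Qed.

Fact cscale1 : left_id 1 cscale.
Proof. by move=> x; rewrite -[x in LHS]repK cscale_limit scale1r repK. Qed.

Fact cscaleDr : right_distributive cscale +%R.
Proof.
move=> a x y; rewrite -[x]repK -[y]repK -raddfD !cscale_limit.
by rewrite scalerDr raddfD.
Qed.

Fact cscaleDl x : {morph cscale^~ x : a b / a + b}.
Proof. by move=> a b; rewrite -[x]repK !cscale_limit scalerDl raddfD. Qed.

HB.instance Definition _ :=
  GRing.Zmodule_isLmodule.Build R completion cscaleA cscale1 cscaleDr cscaleDl.

Lemma limit_of_is_scalable : scalable limit_of.
Proof. by move=> a u; rewrite -cscale_limit. Qed.

HB.instance Definition _ :=
  GRing.isScalable.Build R cseq completion *:%R limit_of limit_of_is_scalable.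

Definition completion_join (x y : completion) : completion :=
  limit_of (vjoin (rep x) (rep y)).

Lemma completion_join_limit (u v : cseq) :
  completion_join (limit_of u) (limit_of v) = limit_of (vjoin u v).
Proof.
apply/limit_of_eq; apply: null_seq_le (null_seqD (rep_limit u) (rep_limit v)) => n.
exact: (psn_join sP).
Qed.

Fact completion_joinC : commutative completion_join.
Proof. by move=> x y; rewrite /completion_join vjoinC. Qed.

Fact completion_joinA : associative completion_join.
Proof.
by move=> x y z; rewrite -[x]repK -[y]repK -[z]repK !completion_join_limit vjoinA.
Qed.

Fact completion_joinxx : idempotent_op completion_join.
Proof. by move=> x; rewrite -[x]repK completion_join_limit vjoinxx. Qed.

Fact completion_joinDr (x y z : completion) :
  completion_join (x + z) (y + z) = completion_join x y + z.
Proof.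
rewrite -[x]repK -[y]repK -[z]repK.
rewrite [completion_join (limit_of (rep x)) _]completion_join_limit -!raddfD.
by rewrite completion_join_limit vjoinDr.
Qed.

Fact completion_joinZ (a : R) (x y : completion) : 0 <= a ->
  completion_join (a *: x) (a *: y) = a *: completion_join x y.
Proof.
move=> a0; rewrite -[x]repK -[y]repK.
rewrite [completion_join (limit_of (rep x)) _]completion_join_limit -!linearZ_LR.
by rewrite completion_join_limit vjoin_scale.
Qed.

HB.instance Definition _ := Lmodule_hasJoin.Build R completion
  completion_joinC completion_joinA completion_joinxx completion_joinDr
  completion_joinZ.

Lemma limit_of_join (u v : cseq) : limit_of (vjoin u v) = vjoin (limit_of u) (limit_of v).
Proof. by rewrite -completion_join_limit. Qed.

Lemma snorm_limit (u : cseq) : exists r : R, null_seq (fun n => `|snorm (u n) - r|).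
Proof.
apply: real_cauchy_limit => eps /(cseqP u)[N NP]; exists N => m n Nm Nn.
exact: le_trans (psn_dist sP _ _) (NP _ _ Nm Nn).
Qed.

(** Like [snorm], this is the [p]-th power of the norm. *)
Definition cnorm (x : completion) : R := sval (cid (snorm_limit (rep x))).

Lemma cnorm_limit (u : cseq) :
  null_seq (fun n => `|snorm (u n) - cnorm (limit_of u)|).
Proof.
rewrite /cnorm; case: cid => r rP /=.
apply: null_seq_le (null_seqD (rep_limit u) rP) => n.
rewrite (le_trans (ler_distD (snorm (rep (limit_of u) n)) _ _))// lerD2r.
by rewrite distrC; exact: psn_dist sP _ _.
Qed.

Lemma cnorm_le (u : cseq) (c : R) : (forall eps : R, 0 < eps ->
    exists n0, forall n, (n0 <= n)%N -> snorm (u n) <= c + eps) ->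
  cnorm (limit_of u) <= c.
Proof.
move=> uc; apply/ler_addgt0Pr => eps eps0.
have eps2 : 0 < eps / 2 by rewrite divr_gt0.
have [N NP] := cnorm_limit u eps2; have [M MP] := uc _ eps2.
have := NP _ (leq_maxl N M); have := MP _ (leq_maxr N M).
by rewrite ler_norml => ? /andP[? ?]; lra.
Qed.

Lemma cnorm_ge (u : cseq) (eps : R) : 0 < eps ->
  exists n0, forall n, (n0 <= n)%N -> snorm (u n) <= cnorm (limit_of u) + eps.
Proof.
move=> eps0; have [N NP] := cnorm_limit u eps0; exists N => n /NP.
by rewrite ler_norml => /andP[_]; rewrite lerBlDl.
Qed.

Lemma cnorm_ge0 x : 0 <= cnorm x.
Proof.
apply/ler_addgt0Pr => eps eps0; have [N NP] := cnorm_ge (rep x) eps0.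
by rewrite -{1}[x]repK; apply: le_trans (NP _ (leqnn N)); exact: psn_ge0 sP _.
Qed.

Lemma cnormD x y : cnorm (x + y) <= cnorm x + cnorm y.
Proof.
rewrite -{1}[x]repK -{1}[y]repK -raddfD; apply: cnorm_le => eps eps0.
have eps2 : 0 < eps / 2 by rewrite divr_gt0.
have [N NP] := cnorm_ge (rep x) eps2; have [M MP] := cnorm_ge (rep y) eps2.
exists (maxn N M) => n; rewrite geq_max => /andP[Nn Mn].
have := NP _ Nn; have := MP _ Mn; rewrite !repK.
have := psnD sP (rep x n) (rep y n); rewrite /= => ? ? ?; lra.
Qed.

Lemma cnormZ_le (a : R) x : cnorm (a *: x) <= `|a| `^ p * cnorm x.
Proof.
rewrite -{1}[x]repK -linearZ_LR; apply: cnorm_le => eps eps0.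
have A0 : 0 < `|a| `^ p + 1 by rewrite ltr_wpDl ?powR_ge0.
have [N NP] := cnorm_ge (rep x) (divr_gt0 eps0 A0).
exists N => n /NP; rewrite repK /= (psnZ sP) => h.
apply: le_trans (ler_wpM2l (powR_ge0 _ _) h) _; rewrite mulrDr lerD2l.
by rewrite mul_divD1_le ?powR_ge0// ltW.
Qed.

Lemma cnormZ (a : R) x : cnorm (a *: x) = `|a| `^ p * cnorm x.
Proof. exact: pseminorm_scale_eq p_gt0 cnorm_ge0 cnormZ_le a x. Qed.

Lemma cnorm_eq0 x : cnorm x <= 0 -> x = 0.
Proof.
move=> x0; rewrite -[x]repK -(raddf0 limit_of); apply/limit_of_eq => eps eps0.
have [N NP] := cnorm_ge (rep x) eps0; exists N => n /NP; rewrite repK subr0.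
by move=> /le_trans; apply; rewrite gerDr.
Qed.

Lemma cnorm_abs_le x y : vle (vabs x) (vabs y) -> cnorm x <= cnorm y.
Proof.
rewrite -[x]repK -[y]repK; set u := rep x; set v := rep y.
have absE (w : cseq) : vabs (limit_of w) = limit_of (vabs w).
  by rewrite /vabs -raddfN -limit_of_join.
rewrite !absE => /vjoin_idPl; rewrite -limit_of_join => /limit_of_eq h.
apply: cnorm_le => eps eps0; have eps2 : 0 < eps / 2 by rewrite divr_gt0.
have [N NP] := h _ eps2; have [M MP] := cnorm_ge v eps2.
exists (maxn N M) => n; rewrite geq_max => /andP[/NP hN /MP hM].
have : snorm (u n) <= snorm (vjoin (vabs (u n)) (vabs (v n))).
  apply: (psn_le sP); exact: vle_joinl.
have := psnD sP (vjoin (vabs (u n)) (vabs (v n)) - vabs (v n)) (vabs (v n)).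
rewrite subrK (psn_vabs sP) => h1 h2; move: hN hM; rewrite /= => hN hM.
have : snorm (vjoin (vabs (u n)) (vabs (v n)) - vabs (v n)) <= eps / 2 by exact: hN.
lra.
Qed.

Lemma cnorm_pseminorm : pseminorm p cnorm.
Proof. by split; [exact: cnorm_ge0|exact: cnormD|exact: cnormZ|exact: cnorm_abs_le]. Qed.

End CauchySequences.

Section CompletionBanach.
Variables (R : realType) (p : R) (W : seminormedLattice p).
Local Notation F := (completion W).

Let p_gt0 := sl_exponent_gt0 W.
Let sP := snormP W.
Let cP : pseminorm p (@cnorm R p W) := @cnorm_pseminorm R p W.

Definition cqnorm (x : F) : R := cnorm x `^ p^-1.

Lemma cqnorm_powR x : cqnorm x `^ p = cnorm x.
Proof. by rewrite /cqnorm powR_rootK// cnorm_ge0. Qed.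

Fact cqnorm_ge0 x : 0 <= cqnorm x. Proof. exact: powR_ge0. Qed.

Fact cqnorm_eq0 x : cqnorm x = 0 -> x = 0.
Proof. by move=> /powR_eq0_eq0 x0; apply: cnorm_eq0; rewrite x0. Qed.

Fact cqnormZ (a : R) x : cqnorm (a *: x) = `|a| * cqnorm x.
Proof.
by rewrite /cqnorm (psnZ cP) powRM ?powR_ge0 ?cnorm_ge0// powR_powK.
Qed.

Fact cqnormD : exists2 D : R, 1 <= D &
  forall x y, cqnorm (x + y) <= D * (cqnorm x + cqnorm y).
Proof.
(* If [a <= b], then [(a + b) `^ p^-1 <= (2 * b) `^ p^-1]. *)
exists (2 `^ p^-1) => [|x y].
  by rewrite -[leLHS](powRr0 2) ler_powR ?ler1n// invr_ge0 ltW.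
have h (a b : R) : 0 <= a -> a <= b -> (a + b) `^ p^-1 <= 2 `^ p^-1 * (b `^ p^-1).
  move=> a0 ab; have b0 := le_trans a0 ab.
  rewrite -powRM// ler_powR2r ?invr_gt0 ?addr_ge0//.
  by rewrite mulr_natl mulr2n lerD2r.
have pV0 : 0 < p^-1 by rewrite invr_gt0.
apply: le_trans (ler_powR2r pV0 (cnorm_ge0 _) (cnormD x y)) _.
have [xy|/ltW yx] := leP (cnorm x) (cnorm y).
  apply: le_trans (h _ _ (cnorm_ge0 x) xy) _.
  by rewrite ler_wpM2l ?powR_ge0// lerDr powR_ge0.
rewrite addrC; apply: le_trans (h _ _ (cnorm_ge0 y) yx) _.
by rewrite ler_wpM2l ?powR_ge0// lerDl powR_ge0.
Qed.

HB.instance Definition _ := Lmodule_isQuasiNormed.Build R F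
  cqnorm_ge0 cqnorm_eq0 cqnormZ cqnormD.

Lemma completion_pnormed : pnormed p F.
Proof. by move=> x y; rewrite ![qnorm _ `^ _]cqnorm_powR cnormD. Qed.

Lemma const_is_cauchy (v : W) : (fun=> v) \in @cauchy_pred R p W.
Proof.
rewrite inE => eps /ltW eps0; exists 0%N => m n _ _.
by rewrite subrr (psn0 p_gt0 sP).
Qed.

Definition const_seq v : cseq W := Cseq (const_is_cauchy v).

Definition cinj (v : W) : F := limit_of (const_seq v).

Lemma cinj_is_linear : linear cinj.
Proof. by move=> a u v; rewrite /cinj -linearP; congr limit_of; exact: val_inj. Qed.

HB.instance Definition _ :=
  GRing.isLinear.Build R W F *:%R cinj cinj_is_linear.

Lemma cinj_join u v : cinj (vjoin u v) = vjoin (cinj u) (cinj v).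
Proof. by rewrite /cinj -limit_of_join; congr limit_of; exact: val_inj. Qed.

Lemma cnorm_cinj v : cnorm (cinj v) = snorm v.
Proof.
apply/eqP; rewrite eq_le; apply/andP; split.
  by apply: cnorm_le => eps eps0; exists 0%N => n _; rewrite /= lerDl ltW.
apply/ler_addgt0Pr => eps /(cnorm_ge (const_seq v))[N NP].
exact: NP (leqnn N).
Qed.

Lemma cinj_dense (u : cseq W) : null_seq (fun m => cnorm (limit_of u - cinj (u m))).
Proof.
move=> eps /(cseqP u)[N NP]; exists N => m Nm.
rewrite /cinj -raddfB; apply: cnorm_le => e e0; exists N => n Nn.
by rewrite (le_trans (NP _ _ Nn Nm))// lerDl ltW.
Qed.

(** Diagonal argument: [U m] is approximated within [1 / (m + 1)] by an element
    [v m] of [W], and the limit of [U] is the class of the sequence [v]. *)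
Fact completion_complete (U : nat -> F) :
  (forall eps : R, 0 < eps -> exists N, forall m n, (N <= m)%N -> (N <= n)%N ->
     qnorm (U m - U n) < eps) ->
  exists l : F, qnorm (U n - l) @[n --> \oo] --> (0 : R).
Proof.
move=> UC.
have cUC eps : 0 < eps -> exists N, forall m n, (N <= m)%N -> (N <= n)%N ->
    cnorm (U m - U n) <= eps.
  move=> eps0; have [N NP] := UC _ (powR_gt0 p^-1 eps0).
  exists N => m n Nm Nn.
  have := ler_powR2r p_gt0 (cqnorm_ge0 _) (ltW (NP m n Nm Nn)).
  by rewrite (cqnorm_powR (U m - U n)) (powR_rootK p_gt0 (ltW eps0)).
have /choice[v vP] (m : nat) : exists v, cnorm (U m - cinj v) <= m.+1%:R^-1.
  rewrite -[U m]repK; have [|N NP] := @cinj_dense (rep (U m)) m.+1%:R^-1.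
    by rewrite invr_gt0.
  by exists (rep (U m) N); exact: NP.
have null_inv := @null_seq_inv R.
have vC : v \in @cauchy_pred R p W.
  rewrite inE => eps eps0; have eps3 : 0 < eps / 3 by rewrite divr_gt0.
  have [N NP] := cUC _ eps3; have [M MP] := null_inv _ eps3.
  exists (maxn N M) => m n; rewrite !geq_max => /andP[Nm /MP Mm] /andP[Nn /MP Mn].
  rewrite -cnorm_cinj raddfB.
  apply: le_trans (psn_triangle cP (U m) _ _) _.
  have := psn_triangle cP (U n) (U m) (cinj (v n)).
  rewrite (psnB cP (cinj (v m))).
  move: (le_trans (vP m) Mm) (le_trans (vP n) Mn) (NP m n Nm Nn) => ? ? ? ?.
  lra.
exists (limit_of (Cseq vC)); apply/null_seqP => [n|]; first exact: cqnorm_ge0.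
apply: null_seq_powR; rewrite ?invr_gt0//; first by move=> n; exact: cnorm_ge0.
apply: null_seq_le (null_seqD null_inv (cinj_dense (Cseq vC))) => n.
apply: le_trans (psn_triangle cP (cinj (v n)) _ _) _.
by rewrite lerD// (psnB cP).
Qed.

HB.instance Definition _ := QuasiNormed_isComplete.Build R F completion_complete.

Fact completion_qnorm_vabs (x y : F) : vle (vabs x) (vabs y) -> qnorm x <= qnorm y.
Proof.
move=> xy; apply: ler_powR2r; rewrite ?invr_gt0 ?cnorm_ge0//.
exact: (psn_abs_le cP).
Qed.

HB.instance Definition _ := isQuasiBanachLattice.Build R F completion_qnorm_vabs.

Lemma pnorm_completion (x : F) : pnorm p x = cnorm x.
Proof. exact: cqnorm_powR. Qed.

Section Extension.
Variables (X : quasiBanachLatticeType R) (g : {linear W -> X}) (K : R).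
Hypotheses (X_pnormed : pnormed p X) (K_ge0 : 0 <= K).
Hypothesis g_join : forall u v, g (vjoin u v) = vjoin (g u) (g v).
Hypothesis g_bounded : forall v, pnorm p (g v) <= K * snorm v.

Let qn := @pnorm R p X.
Let qnP : pseminorm p qn := pnorm_pseminorm p_gt0 X_pnormed.

Lemma image_limit (u : cseq W) : exists y, null_seq (fun n => qn (g (u n) - y)).
Proof.
apply: (pnorm_complete p_gt0) => eps eps0.
have K1 : 0 < K + 1 by rewrite ltr_wpDl.
have [N NP] := cseqP u (divr_gt0 eps0 K1); exists N => m n Nm Nn.
rewrite -raddfB; apply: le_trans (g_bounded _) _.
apply: le_trans (ler_wpM2l K_ge0 (NP m n Nm Nn)) _.
by rewrite mul_divD1_le ?powR_ge0// ltW.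
Qed.

Definition extension (x : F) : X := sval (cid (image_limit (rep x))).

Lemma extension_limit (u : cseq W) :
  null_seq (fun n => qn (g (u n) - extension (limit_of u))).
Proof.
rewrite /extension; case: cid => y yP /=.
apply: null_seq_le (null_seqD (null_seqZ K_ge0 (rep_limit u)) yP) => n.
apply: le_trans (psn_triangle qnP (g (rep (limit_of u) n)) _ _) _.
by rewrite lerD2r (psnB qnP) -raddfB; exact: g_bounded.
Qed.

Lemma extension_unique (u : cseq W) y : null_seq (fun n => qn (g (u n) - y)) ->
  extension (limit_of u) = y.
Proof.
by move=> uy; apply: pnorm_limit_unique X_pnormed _ _ _ (extension_limit u) uy.
Qed.

Lemma extension_cinj v : extension (cinj v) = g v.
Proof.
apply: extension_unique; apply: null_seq_le (@null_seq0 R) => n /=.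
by rewrite subrr (psn0 p_gt0 qnP).
Qed.

Lemma extension_is_linear : linear extension.
Proof.
move=> a x y; rewrite -{1}[x]repK -{1}[y]repK -linearP; apply: extension_unique.
have := null_seqD (null_seqZ (powR_ge0 `|a| p) (extension_limit (rep x)))
  (extension_limit (rep y)).
apply: null_seq_le => n; rewrite !repK /= linearP; exact: (psn_lin qnP).
Qed.

Lemma extension_join x y : extension (vjoin x y) = vjoin (extension x) (extension y).
Proof.
rewrite -{1}[x]repK -{1}[y]repK -limit_of_join; apply: extension_unique.
have := null_seqD (extension_limit (rep x)) (extension_limit (rep y)).
apply: null_seq_le => n; rewrite !repK /= g_join; exact: (psn_join qnP).
Qed.

Lemma extension_bounded x : qn (extension x) <= K * cnorm x.
Proof.
rewrite -[x]repK; set u := rep x; apply/ler_addgt0Pr => eps eps0.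
have K1 : 0 < K + 1 by rewrite ltr_wpDl.
have d0 : 0 < eps / (K + 1) by rewrite divr_gt0.
have [N NP] := extension_limit u d0; have [M MP] := cnorm_ge u d0.
pose n := maxn N M.
have hN := NP n (leq_maxl _ _); have hM := MP n (leq_maxr _ _).
have := psn_triangle qnP (g (u n)) (extension (limit_of u)) 0.
rewrite !subr0 (psnB qnP (extension _)) => /le_trans; apply.
apply: le_trans (lerD hN (g_bounded (u n))) _.
apply: le_trans (lerD (lexx _) (ler_wpM2l K_ge0 hM)) _.
rewrite mulrDr addrCA lerD2l -[X in X + _]mul1r -mulrDl.
by rewrite [1 + K]addrC mulrC divfK ?gt_eqF.
Qed.

End Extension.

End CompletionBanach.

(** * The free vector lattice *)

Section FreeVectorLattice.
Variables (R : realType) (E : lmodType R).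
Local Notation dual := {linear E -> R^o}.

(** The free vector lattice over [E], as a space of functions on the algebraic
    dual of [E]. *)
Definition free_pred : {pred dual -> R^o} :=
  mem [set f | exists w : word E, f = (fun phi : dual => word_eval phi w)].

Lemma free_submod_closed : submod_closed free_pred.
Proof.
split=> [|a _ _ /[!inE] -[w ->] [w' ->]].
  rewrite inE; exists ([::], [::]); apply/funext => phi.
  by rewrite /word_eval /= subrr.
rewrite /=; exists (word_add (word_scale a w) w'); apply/funext => phi.
by rewrite word_eval_add word_eval_scale.
Qed.

HB.instance Definition _ :=
  GRing.isSubmodClosed.Build R (dual -> R^o) free_pred free_submod_closed.

Record free_lattice :=
  FreeLattice { free_val :> dual -> R^o ; free_in : free_val \in free_pred }.

HB.instance Definition _ := [isSub of free_lattice for free_val].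
HB.instance Definition _ := [Choice of free_lattice by <:].
HB.instance Definition _ := [SubChoice_isSubLmodule of free_lattice by <:].

Lemma free_word_in (w : word E) : (fun phi : dual => word_eval phi w) \in free_pred.
Proof. by rewrite inE; exists w. Qed.

Definition of_word (w : word E) : free_lattice := FreeLattice (free_word_in w).

Lemma of_word_surj (f : free_lattice) : exists w, of_word w = f.
Proof. by have := free_in f; rewrite inE => -[w fE]; exists w; exact: val_inj. Qed.

Lemma free_join_in (f g : free_lattice) :
  vjoin (f : dual -> R^o) g \in free_pred.
Proof.
have [[w <-] [w' <-]] := (of_word_surj f, of_word_surj g).
rewrite inE; exists (word_join w w'); apply/funext => phi.
by rewrite word_eval_join.
Qed.

Definition free_join (f g : free_lattice) := FreeLattice (free_join_in f g).

Fact free_joinC : commutative free_join.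
Proof. by move=> u v; apply: val_inj; exact: vjoinC. Qed.

Fact free_joinA : associative free_join.
Proof. by move=> u v w; apply: val_inj; exact: vjoinA. Qed.

Fact free_joinxx : idempotent_op free_join.
Proof. by move=> u; apply: val_inj; exact: vjoinxx. Qed.

Fact free_joinDr (u v w : free_lattice) :
  free_join (u + w) (v + w) = free_join u v + w.
Proof. by apply: val_inj; exact: vjoinDr. Qed.

Fact free_joinZ (a : R) (u v : free_lattice) :
  0 <= a -> free_join (a *: u) (a *: v) = a *: free_join u v.
Proof. by move=> a0; apply: val_inj; exact: vjoin_scale. Qed.

HB.instance Definition _ := Lmodule_hasJoin.Build R free_lattice
  free_joinC free_joinA free_joinxx free_joinDr free_joinZ.

Lemma of_word_add w w' : of_word (word_add w w') = of_word w + of_word w'.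
Proof. by apply: val_inj; apply/funext => phi; rewrite /= word_eval_add. Qed.

Lemma of_word_scale a w : of_word (word_scale a w) = a *: of_word w.
Proof. by apply: val_inj; apply/funext => phi; rewrite /= word_eval_scale. Qed.

Lemma of_word_join w w' : of_word (word_join w w') = vjoin (of_word w) (of_word w').
Proof. by apply: val_inj; apply/funext => phi; rewrite /= word_eval_join. Qed.

Definition generator (e : E) : free_lattice := of_word (word_var e).

Lemma generatorE e (phi : dual) : generator e phi = phi e.
Proof. exact: word_eval_var. Qed.

Lemma generator_is_linear : linear generator.
Proof.
move=> a x y; apply: val_inj; apply/funext => phi.
by rewrite [LHS]generatorE linearP -!generatorE.
Qed.

HB.instance Definition _ := GRing.isLinear.Build R E free_lattice *:%R generator
  generator_is_linear.

Lemma word_eval_generator w : word_eval generator w = of_word w.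
Proof.
apply: val_inj; apply/funext => phi /=.
have [|g gE] := @linear_bundle R free_lattice R^o (fun f => f phi); first by [].
have gj u v : g (vjoin u v) = vjoin (g u) (g v) by rewrite gE.
have := word_eval_hom generator w gj; rewrite {1}gE => h; rewrite [LHS]h.
by apply: eq_word_eval => e /=; rewrite gE; exact: generatorE.
Qed.

Section FreeExtension.
Variables (X : vectorLatticeType R) (T : {linear E -> X}).

(** By [word_transfer] the value does not depend on the word that represents
    [f], which makes the extension linear and join-preserving. *)
Definition free_ext (f : free_lattice) : X :=
  word_eval T (sval (cid (of_word_surj f))).

Lemma free_ext_word w : free_ext (of_word w) = word_eval T w.
Proof.
rewrite /free_ext; case: cid => w' /= /(congr1 free_val) ww'.
by apply: word_transfer_eq => phi; have := congr1 (fun f => f phi) ww'.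
Qed.

Lemma free_ext_is_linear : linear free_ext.
Proof.
move=> a f g; have [[w <-] [w' <-]] := (of_word_surj f, of_word_surj g).
rewrite -of_word_scale -of_word_add !free_ext_word.
by rewrite word_eval_add word_eval_scale.
Qed.

HB.instance Definition _ := GRing.isLinear.Build R free_lattice X *:%R free_ext
  free_ext_is_linear.

Lemma free_ext_join f g : free_ext (vjoin f g) = vjoin (free_ext f) (free_ext g).
Proof.
have [[w <-] [w' <-]] := (of_word_surj f, of_word_surj g).
by rewrite -of_word_join !free_ext_word word_eval_join.
Qed.

Lemma free_ext_generator e : free_ext (generator e) = T e.
Proof. by rewrite free_ext_word word_eval_var. Qed.

End FreeExtension.

End FreeVectorLattice.

(** * The free p-convex seminorm *)

Section FreeSeminorm.
Variables (R : realType) (p : R) (E : quasiNormedType R).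
Hypotheses (p_gt0 : 0 < p) (p_le1 : p <= 1).
Local Notation dual := {linear E -> R^o}.
Local Notation V := (free_lattice E).
Implicit Types (f g : V) (s : seq E).

(** The inequality [`|f| <= (\sum_e `|generator e| `^ p) `^ p^-1], raised to the
    power [p]. *)
Definition dominates s f : Prop :=
  forall phi : dual, `|f phi| `^ p <= \sum_(e <- s) `|phi e| `^ p.

Definition cost s : R := \sum_(e <- s) qnorm e `^ p.

(** The [p]-th power of the largest lattice seminorm that is [p]-convex with
    constant [1] and at most [qnorm e] at [generator e]. *)
Definition free_seminorm f : R := inf [set cost s | s in [set s | dominates s f]].

Lemma cost_ge0 s : 0 <= cost s.
Proof. by apply: sumr_ge0 => e _; exact: powR_ge0. Qed.

(** A word [(s1, s2)] is bounded by the sum of the [`|phi e|] over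
    [s1 ++ s2], and [p <= 1] bounds that sum by the [p]-sum. *)
Lemma dominates_exists f : exists s, dominates s f.
Proof.
have [[s1 s2] <-] := of_word_surj f; exists (s1 ++ s2) => phi.
have vmax_le s : 0 <= (vmax0 (map phi s) : R) <= \sum_(e <- s) `|phi e|.
  elim: s => [|e s IH] /=; first by rewrite big_nil lexx.
  have /andP[h1 h2] := IH.
  rewrite big_cons vjoin_realE le_max h1 orbT ge_max (le_trans (ler_norm _)) ?lerDl//=.
    by rewrite (le_trans h2)// lerDr.
  exact: le_trans h1 h2.
apply: le_trans (powR_sum_le p_gt0 (s1 ++ s2) p_le1 (fun e => normr_ge0 (phi e))).
apply: ler_powR2r => //; rewrite /= /word_eval /= big_cat /= ler_norml.
have /andP[h1 h2] := vmax_le s1; have /andP[h3 h4] := vmax_le s2.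
apply/andP; split; move: h1 h2 h3 h4; set a := vmax0 _; set b := vmax0 _ => h1 h2 h3 h4.
  rewrite lerBrDl (le_trans _ h1)// subr_le0 (le_trans h4)// lerDr.
  exact: le_trans h1 h2.
rewrite lerBlDr (le_trans h2)// -addrA lerDl addr_ge0//.
exact: le_trans h3 h4.
Qed.

Lemma free_seminorm_has_inf f : has_inf [set cost s | s in [set s | dominates s f]].
Proof.
split; first by have [s sf] := dominates_exists f; exists (cost s), s.
by exists 0 => _ [s _ <-]; exact: cost_ge0.
Qed.

Lemma free_seminorm_le s f : dominates s f -> free_seminorm f <= cost s.
Proof.
by move=> sf; apply: ge_inf; [case: (free_seminorm_has_inf f)|exists s].
Qed.

Lemma free_seminorm_ge (a : R) f : (forall s, dominates s f -> a <= cost s) ->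
  a <= free_seminorm f.
Proof.
move=> af; apply: lb_le_inf; first by case: (free_seminorm_has_inf f).
by move=> _ [s sf <-]; exact: af.
Qed.

Lemma free_seminorm_ge0 f : 0 <= free_seminorm f.
Proof. by apply: free_seminorm_ge => s _; exact: cost_ge0. Qed.

Lemma free_seminorm_adherent f (eps : R) : 0 < eps ->
  exists2 s, dominates s f & cost s <= free_seminorm f + eps.
Proof.
move=> eps0; have [_ [s sf <-] h] := inf_adherent eps0 (free_seminorm_has_inf f).
by exists s => //; exact: ltW.
Qed.

Lemma family_dominated (fs : seq V) (eps : R) : 0 < eps ->
  exists2 s, forall phi : dual,
      \sum_(f <- fs) `|f phi| `^ p <= \sum_(e <- s) `|phi e| `^ p &
    cost s <= \sum_(f <- fs) free_seminorm f + eps.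
Proof.
elim: fs eps => [|f fs IH] eps eps0.
  exists [::] => [phi|]; first by rewrite !big_nil.
  by rewrite /cost !big_nil add0r ltW.
have eps2 : 0 < eps / 2 by rewrite divr_gt0.
have [s sf sc] := free_seminorm_adherent f eps2; have [s' sf' sc'] := IH _ eps2.
exists (s ++ s') => [phi|]; first by rewrite big_cons big_cat lerD.
by rewrite /cost big_cat big_cons [eps]splitr addrACA lerD.
Qed.

(** Nearly optimal families for the members of [fs] are concatenated into a
    family that dominates [f]. The triangle inequality and monotonicity are the
    cases of two members and of one member. *)
Lemma free_seminorm_pconvex (fs : seq V) f :
  (forall phi : dual, `|f phi| `^ p <= \sum_(g <- fs) `|g phi| `^ p) ->
  free_seminorm f <= \sum_(g <- fs) free_seminorm g.
Proof.
move=> ffs; apply/ler_addgt0Pr => eps eps0.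
have [s sfs sc] := family_dominated fs eps0.
apply: le_trans sc; apply: free_seminorm_le => phi.
exact: le_trans (ffs phi) (sfs phi).
Qed.

Lemma free_seminormP : pseminorm p free_seminorm.
Proof.
split; first exact: free_seminorm_ge0.
- move=> f g; have := @free_seminorm_pconvex [:: f; g] (f + g).
  rewrite !big_cons big_nil addr0; apply => phi; rewrite !big_cons big_nil addr0.
  apply: le_trans (powR_add_le p_gt0 p_le1 (normr_ge0 _) (normr_ge0 _)).
  by apply: ler_powR2r => //; exact: ler_normD.
- apply: (pseminorm_scale_eq p_gt0 free_seminorm_ge0) => a f.
  apply/ler_addgt0Pr => eps eps0.
  have A0 : 0 < `|a| `^ p + 1 by rewrite ltr_wpDl ?powR_ge0.
  have [s sf sc] := free_seminorm_adherent f (divr_gt0 eps0 A0).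
  apply: (@le_trans _ _ (`|a| `^ p * cost s)).
    have -> : `|a| `^ p * cost s = cost [seq a *: e | e <- s].
      rewrite /cost big_map mulr_sumr; apply: eq_bigr => e _.
      by rewrite qnormZ powRM ?qnorm_ge0.
    apply: free_seminorm_le => phi; rewrite big_map.
    have -> : \sum_(e <- s) `|phi (a *: e)| `^ p =
        `|a| `^ p * \sum_(e <- s) `|phi e| `^ p.
      by rewrite mulr_sumr; apply: eq_bigr => e _; rewrite linearZ_LR normrM powRM.
    by rewrite [X in `|X|]/(a * f phi) normrM powRM// ler_wpM2l ?powR_ge0.
  apply: le_trans (ler_wpM2l (powR_ge0 _ _) sc) _; rewrite mulrDr lerD2l.
  by rewrite mul_divD1_le ?powR_ge0// ltW.
- move=> f g /vjoin_idPl fg; have := @free_seminorm_pconvex [:: g] f.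
  rewrite !big_seq1; apply => phi; rewrite big_seq1 ler_powR2r//.
  have := congr1 (fun h : V => h phi) fg; rewrite -!vabs_realE => h.
  by apply/vle_realE/vjoin_idPl.
Qed.

Definition free_seminormed : seminormedLattice p :=
  SeminormedLattice free_seminormP p_gt0.

Lemma free_seminorm_generator e : free_seminorm (generator e) <= qnorm e `^ p.
Proof.
have -> : qnorm e `^ p = cost [:: e] by rewrite /cost big_seq1.
by apply: free_seminorm_le => phi; rewrite big_seq1 generatorE.
Qed.

(** Each dominating family bounds the image of [f] by [pconvex_word_bound]; the
    infimum over these families is the seminorm. *)
Lemma free_ext_bounded (X : quasiBanachLatticeType R) (T : {linear E -> X})
    (C K : R) : pnormed p X -> 0 <= C -> pconvex_with p X C -> 0 <= K ->
  (forall e, qnorm (T e) <= K * qnorm e) ->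
  forall f, pnorm p (free_ext T f) <= (C * K) `^ p * free_seminorm f.
Proof.
move=> Xp C0 XC K0 TK f; rewrite powRM//.
have bound s : dominates s f ->
    pnorm p (free_ext T f) <= C `^ p * K `^ p * cost s.
  have [w <-] := of_word_surj f => ws; rewrite free_ext_word.
  apply: le_trans (@pconvex_word_bound R p X p_gt0 Xp C E T w s C0 XC ws) _.
  rewrite -mulrA ler_wpM2l ?powR_ge0// mulr_sumr; apply: ler_sum => e _.
  by rewrite -powRM ?qnorm_ge0// ler_powR2r ?qnorm_ge0.
have CK0 : 0 <= C `^ p * K `^ p by rewrite mulr_ge0 ?powR_ge0.
apply/ler_addgt0Pr => eps eps0.
have D0 : 0 < C `^ p * K `^ p + 1 by rewrite ltr_wpDl.
have [s sf sc] := free_seminorm_adherent f (divr_gt0 eps0 D0).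
apply: le_trans (bound s sf) _; apply: le_trans (ler_wpM2l CK0 sc) _.
by rewrite mulrDr lerD2l mul_divD1_le// ltW.
Qed.

End FreeSeminorm.

(** * The free p-convex p-Banach lattice *)

Section FreeBanachLattice.
Variables (R : realType) (p : R).
Hypotheses (p_gt0 : 0 < p) (p_le1 : p <= 1).
Variable E : quasiBanachType R.

Local Notation V := (free_seminormed E p_gt0 p_le1).
Local Notation F := (completion V).
Local Notation dual := {linear E -> R^o}.

Definition free_embedding (e : E) : F := cinj (generator e : V).

Lemma free_embedding_is_linear : linear free_embedding.
Proof. by move=> a x y; rewrite /free_embedding !linearP. Qed.

HB.instance Definition _ :=
  GRing.isLinear.Build R E F *:%R free_embedding free_embedding_is_linear.

(** Since [p <= 1], the [p]-th power of the bound [lp_fun p t + eps * l1norm t]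
    on the word is at most the sum of the [p]-th powers of the coordinates of
    [t] and of [eps *: t]; so [free_seminorm_pconvex] applies to the [f k]
    together with the [eps *: f k]. *)
Lemma seminorm_word_lp n (f : 'I_n -> V) (w : word 'rV[R]_n) (eps : R) : 0 <= eps ->
  (forall t, `|lp_fun p t - word_fun w t| <= eps * l1norm t) ->
  snorm (word_eval (lincomb f) w) <= (1 + eps `^ p) * \sum_k snorm (f k).
Proof.
move=> eps0 hw; have sP := snormP V.
pose r := index_enum 'I_n.
pose fs : seq V := map f r ++ [seq eps *: f k | k <- r].
have -> : (1 + eps `^ p) * \sum_k snorm (f k) = \sum_(g <- fs) snorm g.
  rewrite big_cat mulrDl mul1r mulr_sumr !big_map; congr (_ + _).
  by apply: eq_bigr => k _; rewrite (psnZ sP) ger0_norm.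
apply: free_seminorm_pconvex => // phi.
have [|g gE] := @linear_bundle R V R^o (fun f : V => (f : dual -> R^o) phi); first by [].
have gj (u v : V) : g (vjoin u v) = vjoin (g u) (g v) by rewrite gE.
pose t : 'rV[R]_n := \row_k (f k : dual -> R^o) phi.
have -> : (word_eval (lincomb f) w : dual -> R^o) phi = word_fun w t.
  have := word_eval_hom (lincomb f) w gj; rewrite {1}gE => h; rewrite [LHS]h.
  apply: eq_word_eval => c /=; rewrite /lincomb linear_sum.
  by apply: eq_bigr => k _; rewrite linearZ_LR mxE gE.
have lp0 : 0 <= lp_fun p t by exact: powR_ge0.
have wt : `|word_fun w t| <= lp_fun p t + eps * l1norm t.
  rewrite -[word_fun w t](subrKC (lp_fun p t)) (le_trans (ler_normD _ _))//.
  by rewrite ger0_norm// lerD2l distrC.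
apply: le_trans (ler_powR2r p_gt0 (normr_ge0 _) wt) _.
apply: le_trans (powR_add_le p_gt0 p_le1 lp0 _) _.
  by rewrite mulr_ge0// l1norm_ge0.
rewrite lp_fun_powR// big_cat !big_map lerD//.
  by apply: ler_sum => k _; rewrite mxE.
rewrite /l1norm mulr_sumr.
apply: le_trans (powR_sum_le p_gt0 _ p_le1 _) _; first by move=> k; rewrite mulr_ge0.
apply: ler_sum => k _; rewrite mxE.
by rewrite [X in _ <= `|X| `^ _]/(eps * _) normrM (ger0_norm eps0).
Qed.

(** The element [krivine x lp_fun] is the limit of words at [x]. Representing
    each [x k] by a Cauchy sequence, these words are evaluated term by term in
    the free vector lattice, where [seminorm_word_lp] bounds them. *)
Lemma free_pconvex : pconvex_with p F 1.
Proof.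
move=> n x; have Fp := @completion_pnormed R p V.
have qnP := pnorm_pseminorm p_gt0 Fp.
set y := krivine x _.
have yV : calculus_value p x (@lp_fun R p n) y by exact: krivine_value (Hcone_lp p_gt0 n).
pose S := \sum_k pnorm p (x k).
have S0 : 0 <= S by apply: sumr_ge0 => k _; exact: psn_ge0 qnP _.
suff yS : pnorm p y <= S.
  rewrite mul1r -(pnorm_rootK p_gt0 y).
  by apply: ler_powR2r (psn_ge0 qnP y) yS; rewrite invr_gt0.
apply/ler_addgt0Pr => eps eps0; have eps2 : 0 < eps / 2 by rewrite divr_gt0.
have [d d0 [dle dS]] := small_scale p_gt0 S0 eps2.
have [w [hw yw]] := yV _ d0.
pose u k := rep (x k).
have evE : word_eval (lincomb x) w = limit_of (word_eval (lincomb u) w).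
  rewrite word_eval_hom; last exact: limit_of_join.
  apply: eq_word_eval => c /=; rewrite /lincomb linear_sum.
  by apply: eq_bigr => k _; rewrite linearZ_LR /= repK.
have evn m : (word_eval (lincomb u) w : cseq V) m = word_eval (lincomb (fun k => u k m)) w.
  have [|g gE] := @linear_bundle R (cseq V) V (fun v : cseq V => v m); first by [].
  have gj (v v' : cseq V) : g (vjoin v v') = vjoin (g v) (g v') by rewrite gE.
  have := word_eval_hom (lincomb u) w gj; rewrite {1}gE => h; rewrite [LHS]h.
  apply: eq_word_eval => c /=; rewrite /lincomb linear_sum.
  by apply: eq_bigr => k _; rewrite linearZ_LR gE.
have evS : pnorm p (word_eval (lincomb x) w) <= (1 + d `^ p) * S.
  rewrite evE pnorm_completion; apply: cnorm_le => e e0.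
  have D0 : 0 < 1 + d `^ p by rewrite ltr_pwDl// powR_ge0.
  have /(_ _ (divr_gt0 e0 D0))[N NP] :=
    null_seq_sum (index_enum 'I_n) (fun k => cnorm_limit (u k)).
  exists N => m /NP h; rewrite evn.
  apply: le_trans (seminorm_word_lp _ (ltW d0) hw) _.
  have -> : (1 + d `^ p) * S + e = (1 + d `^ p) * (S + e / (1 + d `^ p)).
    by field; rewrite gt_eqF.
  rewrite ler_wpM2l ?(ltW D0)// -lerBlDl; apply: le_trans h.
  rewrite -sumrB; apply: ler_sum => k _.
  by rewrite (le_trans _ (ler_norm _))// lerD2l lerN2 repK pnorm_completion.
rewrite -[y](subrK (word_eval (lincomb x) w)); apply: le_trans (psnD qnP _ _) _.
rewrite [eps]splitr addrA [leRHS]addrC; apply: lerD (le_trans yw dle) _.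
by apply: le_trans evS _; rewrite mulrDl mul1r lerD2l.
Qed.

Lemma free_pconvexity_constant : pconvexity_constant p F = 1.
Proof.
apply/eqP; rewrite eq_le; apply/andP; split.
  apply: ge_inf; last by split=> //; exact: free_pconvex.
  by exists 1 => a [].
apply: lb_le_inf; first by exists 1; split=> //; exact: free_pconvex.
by move=> a [].
Qed.

(** The embedding [j] of [E] into a [p]-convex lattice of constant [1] extends to
    the free vector lattice with norm at most [1], so the free norm of
    [generator e] is at least the norm of [j e], which is that of [e]. *)
Lemma free_embedding_isometric : pnatural p E -> forall e, qnorm (free_embedding e) = qnorm e.
Proof.
move=> [X [j [Xp Xc XM [jl jn]]]] e.
have [J JE] := linear_bundle jl.
have [_ X1] := pconvexity_constantP Xc; rewrite XM in X1.
have -> : qnorm (free_embedding e) = free_seminorm p (generator e) `^ p^-1.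
  by rewrite [LHS]/(cnorm (cinj (generator e : V)) `^ p^-1) cnorm_cinj.
have -> : free_seminorm p (generator e) = qnorm e `^ p.
  apply/eqP; rewrite eq_le free_seminorm_generator//=.
  have Jb f : qnorm (J f) <= 1 * qnorm f by rewrite JE jn mul1r.
  have := free_ext_bounded p_gt0 p_le1 Xp ler01 X1 ler01 Jb (generator e).
  by rewrite free_ext_generator /pnorm JE jn mul1r powR1 mul1r.
by rewrite powR_powK// qnorm_ge0.
Qed.

Section UniversalProperty.
Variables (X : quasiBanachLatticeType R) (T : {linear E -> X}).
Hypotheses (Xp : pnormed p X) (Xc : pconvex p X) (T_cont : qcontinuous T).

Let M := pconvexity_constant p X.
Let K := M * opnorm T.

Let M1 : 1 <= M. Proof. by have [] := pconvexity_constantP Xc. Qed.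

Let K0 : 0 <= K.
Proof. by rewrite mulr_ge0 ?(le_trans ler01 M1)// opnorm_ge0. Qed.

Let bounded f : pnorm p (free_ext T f : X) <= K `^ p * snorm (f : V).
Proof.
have [_ XM] := pconvexity_constantP Xc.
apply: free_ext_bounded => //; first exact: le_trans ler01 M1.
  exact: opnorm_ge0.
exact: qnorm_le_opnorm.
Qed.

Definition free_lift : F -> X := @extension R p V X (free_ext T) (K `^ p) (powR_ge0 K p) bounded.

Lemma free_lift_embedding e : free_lift (free_embedding e) = T e.
Proof. by rewrite /free_lift extension_cinj//; exact: free_ext_generator. Qed.

Lemma free_lift_bounded x : qnorm (free_lift x) <= K * qnorm x.
Proof.
have Kx : 0 <= K * qnorm x by rewrite mulr_ge0 ?qnorm_ge0.
rewrite -(powR_leE p_gt0 (qnorm_ge0 _) Kx) powRM ?qnorm_ge0//.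
have := @extension_bounded R p V X (free_ext T) (K `^ p) Xp (powR_ge0 K p) bounded x.
by rewrite -pnorm_completion.
Qed.

Lemma free_lift_linear : linear free_lift.
Proof. exact: extension_is_linear. Qed.

Lemma free_lift_hom : lattice_hom free_lift.
Proof.
have lj x y : free_lift (vjoin x y) = vjoin (free_lift x) (free_lift y).
  by apply: extension_join => //; exact: free_ext_join.
have [L LE] := linear_bundle free_lift_linear.
split=> [|//|x y].
  split; first exact: free_lift_linear.
  rewrite -LE; apply: (@bounded_qcontinuous _ _ _ L K) => x; rewrite LE.
  exact: free_lift_bounded.
have lN z : free_lift (- z) = - free_lift z by rewrite -LE raddfN.
by rewrite !vmeetE lN lj !lN.
Qed.

End UniversalProperty.

(** The generators determine a lattice homomorphism on words, and these are
    dense. *)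
Lemma lattice_hom_unique (X : quasiBanachLatticeType R) (S S' : F -> X) :
  pnormed p X -> lattice_hom S -> lattice_hom S' ->
  (forall e, S (free_embedding e) = S' (free_embedding e)) -> S = S'.
Proof.
move=> Xp [[Sl Sc] Sj _] [[Sl' Sc'] Sj' _] SS'.
have [L LE] := linear_bundle Sl; have [L' LE'] := linear_bundle Sl'.
have onV (f : V) : S (cinj f) = S' (cinj f).
  have [w <-] := of_word_surj f.
  have cinjE : cinj (of_word w : V) = word_eval free_embedding w.
    rewrite -word_eval_generator; apply: word_eval_hom; exact: cinj_join.
  have hom (T : F -> X) (G : {linear F -> X}) : G = T :> (F -> X) ->
      (forall x y, T (vjoin x y) = vjoin (T x) (T y)) ->
      T (word_eval free_embedding w) = word_eval (T \o free_embedding) w.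
    by move=> GE Tj; rewrite -GE; apply: word_eval_hom => x y; rewrite GE; exact: Tj.
  rewrite cinjE (hom S L LE Sj) (hom S' L' LE' Sj').
  exact: eq_word_eval SS'.
apply/funext => x; rewrite -[x]repK; set u := rep x.
have lim (T : F -> X) (G : {linear F -> X}) : G = T :> (F -> X) -> qcontinuous T ->
    null_seq (fun n => pnorm p (T (cinj (u n)) - T (limit_of u))).
  move=> GE Tc; rewrite -GE in Tc *.
  have [C C0 CP] := operator_bounded Tc.
  apply: null_seq_le (null_seqZ (powR_ge0 C p) (cinj_dense u)) => n.
  rewrite -raddfB (psnB (@cnorm_pseminorm R p V)).
  rewrite -(pnorm_completion (cinj (u n) - limit_of u)) /pnorm.
  rewrite -powRM ?qnorm_ge0//; apply: (ler_powR2r p_gt0 (qnorm_ge0 _)); exact: CP.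
apply: (pnorm_limit_unique p_gt0 Xp) (lim S L LE Sc) _.
have := lim S' L' LE' Sc'; congr null_seq; apply/funext => n.
by rewrite onV.
Qed.

End FreeBanachLattice.

Theorem theorem4p3 (R : realType) (p : R) (p_gt0 : 0 < p) (p_le1 : p <= 1)
    (E : quasiBanachType R) (E_natural : pnatural p E) :
  exists (F : quasiBanachLatticeType R) (delta : E -> F),
    [/\ pnormed p F, pconvex p F, pconvexity_constant p F = 1,
        isometric_embedding delta &
        forall (X : quasiBanachLatticeType R) (T : E -> X),
          pnormed p X -> pconvex p X -> operator T ->
          exists2 That : F -> X,
            unique (fun S : F -> X =>
                      lattice_hom S /\ (forall e, S (delta e) = T e)) That &
            opnorm That <= pconvexity_constant p X * opnorm T].
Proof.
exists (completion (free_seminormed E p_gt0 p_le1)),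
  (@free_embedding R p p_gt0 p_le1 E).
split.
- exact: completion_pnormed.
- by exists 1 => //; exact: free_pconvex.
- exact: free_pconvexity_constant.
- split; [exact: free_embedding_is_linear|exact: free_embedding_isometric].
move=> X T0 Xp Xc [Tl]; have [T <-] := linear_bundle Tl => Tc.
exists (free_lift Xp Xc Tc).
  split; first by split; [exact: free_lift_hom|exact: free_lift_embedding].
  move=> S [Sh SE]; apply: (lattice_hom_unique Xp (free_lift_hom p_gt0 p_le1 Xp Xc Tc) Sh) => e.
  by rewrite SE free_lift_embedding.
apply: opnorm_le; last exact: free_lift_bounded.
have [M1 _] := pconvexity_constantP Xc.
by rewrite mulr_ge0 ?(le_trans ler01 M1)// opnorm_ge0.
Qed.
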